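(* Let $b$ be a birth-death chain over $(X,m)$ with $X=\mathbb N_0$. The following statements are equivalent: (i) The Neumann semigroup is Feller. (ii) For every $\alpha>0$, every $\alpha$-harmonic function in $\ell^1(X,m)$ is trivial (i.e., identically $0$). (ii$'$) For every $\alpha>0$, every positive $\alpha$-harmonic function in $\ell^1(X,m)$ is trivial. (iii) We have $m(X)=\infty$ or $$\sum_{r=0}^\infty\frac1{b(r,r+1)}=\infty=\sum_{r=0}^\infty\frac{m(B_r^c)}{b(r,r+1)},$$ where $B_r^c=\{r+1,r+2,r+3,\dots\}$.
   Context: A birth-death chain over $(X,m)$, $X=\mathbb N_0$, consists of $m:X\to(0,\infty)$ and a map $b:X\times X\to[0,\infty)$ with $b(x,y)=b(y,x)$ and $b(x,y)>0$ if and only if $|x-y|=1$ (there is no killing term). For $A\subseteq X$, $m(A)=\sum_{x\in A}m(x)\in[0,\infty]$. $C_c(X)$ denotes the finitely supported functions; $\ell^p(X,m)$, $p\in[1,\infty)$, is the space of $f:X\to\mathbb R$ with $\sum_x|f(x)|^pm(x)<\infty$. For $f:X\to\mathbb R$ the formal Laplacian is $\Delta f(x)=\frac1{m(x)}\sum_yb(x,y)(f(x)-f(y))$. For $\alpha>0$, $u:X\to\mathbb R$ is $\alpha$-harmonic if $(\Delta+\alpha)u=0$. Positive means $u\ge0$. Neumann semigroup: $Q^{(N)}(f)=\frac12\sum_{x,y}b(x,y)(f(x)-f(y))^2$ with domain all $f\in\ell^2(X,m)$ for which this is finite; $L^{(N)}$ is the associated nonnegative self-adjoint operator on $\ell^2(X,m)$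 and $P^{(N)}_t=e^{-tL^{(N)}}$ the Neumann semigroup. Feller property: $C_0(X)$ is the closure of $C_c(X)$ in the supremum norm. The semigroup $P_t$ is Feller if $P_t(C_c(X))\subseteq C_0(X)$ for some (equivalently, all) $t>0$. *)

(* Defs.v *)
From HB Require Import structures.
From mathcomp Require Import all_boot all_order all_algebra.
From mathcomp Require Import all_classical all_reals all_analysis.

Set Implicit Arguments.
Unset Strict Implicit.
Unset Printing Implicit Defensive.

Import Order.TTheory GRing.Theory Num.Theory.
Import numFieldNormedType.Exports.

Local Open Scope classical_set_scope.
Local Open Scope ring_scope.

Section BirthDeath.
Context {R : realType}.
Implicit Types (m : nat -> R) (b : nat -> nat -> R) (f g h u : nat -> R).

Record birth_death_chain m b : Prop := BirthDeathChain {
  vertex_measure_gt0 : forall x, 0 < m x;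
  weight_ge0 : forall x y, 0 <= b x y;
  weight_sym : forall x y, b x y = b y x;
  weight_gt0 : forall x y, 0 < b x y <-> `|x - y|%N = 1%N }.

Definition vertex_measure m (A : set nat) : \bar R := (\esum_(x in A) (m x)%:E)%E.

Definition ell m (p : R) f : Prop :=
  (\sum_(0 <= x <oo) (`|f x| `^ p * m x)%:E < +oo)%E.

(* For f and g in ell m 2 the series converges absolutely, so this limit is the
   inner product of l^2(X, m). *)
Definition inner_prod m f g : R := limn [series f x * g x * m x]_x.

Definition laplacian m b f (x : nat) : R :=
  (m x)^-1 * limn [series b x y * (f x - f y)]_y.

Definition alpha_harmonic m b (alpha : R) u : Prop :=
  forall x, laplacian m b u x + alpha * u x = 0.

Definition energy b f : \bar R :=
  (2^-1%:E * \sum_(0 <= x <oo) \sum_(0 <= y <oo) (b x y * (f x - f y) ^+ 2)%:E)%E.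

Definition neumann_dom m b f : Prop := ell m 2 f /\ (energy b f < +oo)%E.

(* The symmetric bilinear form whose diagonal is the energy; the inner sums are
   finite and the outer one converges absolutely on neumann_dom. *)
Definition energy_form b f g : R :=
  2^-1 * limn [series limn [series b x y * (f x - f y) * (g x - g y)]_y]_x.

(* The graph of the self-adjoint operator of the Neumann form:
   f is in the operator domain and is mapped to g. *)
Definition neumann_laplacian m b f g : Prop :=
  [/\ neumann_dom m b f, ell m 2 g &
      forall h, neumann_dom m b h -> energy_form b f h = inner_prod m g h].

(* U is a unitary operator from l^2(X, m) onto L^2(T, mu); elements of L^2 are
   given by representatives, whence the almost everywhere equalities. Nothing is
   required of U outside l^2. *)
Record unitary_onto_L2 m d (T : measurableType d)
    (mu : {measure set T -> \bar R}) (U : (nat -> R) -> T -> R) : Prop :=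
  UnitaryOntoL2 {
    unitary_L2 : forall f, ell m 2 f -> U f \in Lfun mu 2%:E;
    unitary_linear : forall (a : R) f g, ell m 2 f -> ell m 2 g ->
      {ae mu, forall t, U (fun x => a * f x + g x) t = a * U f t + U g t};
    unitary_isometry : forall f, ell m 2 f ->
      (\int[mu]_t ((U f t) ^+ 2)%:E = \sum_(0 <= x <oo) ((f x) ^+ 2 * m x)%:E)%E;
    unitary_onto : forall F : T -> R, F \in Lfun mu 2%:E ->
      exists2 f, ell m 2 f & {ae mu, forall t, U f t = F t} }.

(* U diagonalizes the operator with graph A, i.e., U A U^-1 is the maximal
   operator of multiplication by phi >= 0 on L^2(T, mu). As U maps l^2 onto L^2,
   the equivalence below also expresses equality of the domains. *)
Record spectral_representation m (A : (nat -> R) -> (nat -> R) -> Prop)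
    d (T : measurableType d) (mu : {measure set T -> \bar R})
    (phi : T -> R) (U : (nat -> R) -> T -> R) : Prop :=
  SpectralRepresentation {
    spectral_unitary : unitary_onto_L2 m mu U;
    spectral_measurable : measurable_fun setT phi;
    spectral_ge0 : forall t, 0 <= phi t;
    spectral_graph : forall f g, ell m 2 f -> ell m 2 g ->
      (A f g <-> {ae mu, forall t, U g t = phi t * U f t}) }.

(* P s = exp(- s A) on l^2(X, m) for all s >= 0, in the sense of the functional
   calculus of a nonnegative self-adjoint operator (given by its graph A):
   exp(- s A) = U^-1 M_{exp(- s phi)} U whenever A = U^-1 M_phi U. By the spectral
   theorem such a P exists, and its restriction to l^2 is unique (it does not
   depend on the representation). Values outside l^2 are irrelevant. *)
Definition is_exp_semigroup m (A : (nat -> R) -> (nat -> R) -> Prop)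
    (P : R -> (nat -> R) -> nat -> R) : Prop :=
  exists (d : measure_display) (T : measurableType d)
    (mu : {measure set T -> \bar R}) (phi : T -> R) (U : (nat -> R) -> T -> R),
    spectral_representation m A mu phi U /\
    forall (s : R) f, 0 <= s -> ell m 2 f ->
      ell m 2 (P s f) /\
      {ae mu, forall t, U (P s f) t = expR (- (s * phi t)) * U f t}.

Definition is_neumann_semigroup m b (P : R -> (nat -> R) -> nat -> R) : Prop :=
  is_exp_semigroup m (neumann_laplacian m b) P.

Definition Cc f : Prop := finite_set [set x | f x != 0].

Definition C0 f : Prop :=
  forall e : R, 0 < e -> exists2 g, Cc g & forall x, `|f x - g x| <= e.

Definition feller (P : R -> (nat -> R) -> nat -> R) : Prop :=
  exists2 t : R, 0 < t & forall f, Cc f -> C0 (P t f).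

End BirthDeath.

(* Main.v *)
Require Import Defs.
From HB Require Import structures.
From mathcomp Require Import all_boot all_order all_algebra.
From mathcomp Require Import all_classical all_reals all_analysis.
From mathcomp Require Import measurable_realfun ring lra zify.

Set Implicit Arguments.
Unset Strict Implicit.
Unset Printing Implicit Defensive.

Import Order.TTheory GRing.Theory Num.Theory.
Import numFieldNormedType.Exports.

Local Open Scope classical_set_scope.
Local Open Scope ring_scope.

(** Write [c r] for the weight of the edge between [r] and [r + 1]. Each of
    the four conditions says that the series of the terms [m(B_r^c) / c r],
    with values in [[0, +oo]], diverges. For (iii) this is elementary
    ([volume_conditionP]): an infinite mass makes all terms infinite, and a
    finite mass makes the series converge as soon as the series of the [1 /
    c r] does. Convergence, [entrance_at_infinity], means that the chain
    comes down from infinity in finite time: the sum is the mean time that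
    the chain started at infinity needs to reach 0.

    Harmonic functions. Summing the harmonic equation over [{0, ..., r}]
    gives [c r * (u (r + 1) - u r) = alpha * S r], where [S r] is the sum of
    [m * u] over [{0, ..., r}]. So the harmonic functions are the multiples
    of one positive increasing function, and the sum of [m * u] over [{0,
    ..., K}] is, up to the term with [u 0], [alpha] times the sum over [r <
    K] of [S r * m({r+1, ..., K}) / c r]. Bounding [S r] from below by [m 0
    * u 0] gives divergence of [S] if the series diverges; bounding it by [S
    K] gives boundedness if the series converges and [alpha] is small.

    The semigroup. It is the pointwise limit of the powers of the resolvents
    [(1 + (t / n) L)^-1] ([semigroup_as_resolvent_limit]); in the spectral
    representation this reduces to an estimate of [(1 + y)^-n - e^(-ny)]
    that is uniform in [y >= 0]. The equation [g + eps L g = f] is used only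
    through two consequences, collected in the relation [resolves]: testing
    the form with the indicator of [{0, ..., r}] gives the flux of [g]
    through the edge [(r, r + 1)], and, if the mass is finite, testing with
    1 shows that no mass is lost at infinity. They are enough for the
    maximum principles [resolves_ge0] and [resolves_nonincreasing].

    If the series diverges: the iterated resolvents [g] of the indicator of
    [{0, ..., N}] are nonincreasing, and summing the flux equation over the
    [n] steps of length [eps] gives [g n K * sum_(N <= r < K) m({r+1, ...,
    K}) / c r <= n * eps] ([iterates_decay]). Letting [n] tend to infinity
    with [n * eps = t], the semigroup applied to the indicator vanishes at
    infinity.

    If the series converges: the function [h x = sum_(N <= r < x) m(B_r^c) /
    c r], which is the mean time from [x] to [N], is at most [t / 2] for [N]
    large, and [L h >= 1 - kappa * 1_{0, ..., N}]. Comparing it with the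
    iterated resolvents gives a lower bound, uniform in the starting point,
    for the time spent in [{0, ..., N}] up to time [t], hence also for the
    semigroup at time [t] itself ([entrance_iterates_lower_bound]), which
    then does not vanish at infinity. *)

(** * Series with bounded partial sums *)

Section BoundedSums.
Context {R : realType}.
Implicit Types (a m f g : nat -> R).

Definition bounded_sums a : Prop :=
  exists C : R, forall n, \sum_(0 <= k < n) a k <= C.

Lemma bounded_sums_le a a' :
  (forall k, a k <= a' k) -> bounded_sums a' -> bounded_sums a.
Proof.
move=> le_aa' [C bC]; exists C => n; apply: le_trans (bC n).
by apply: ler_sum => k _.
Qed.

Lemma bounded_sumsD a a' :
  bounded_sums a -> bounded_sums a' -> bounded_sums (fun k => a k + a' k).
Proof.
move=> [C bC] [C' bC']; exists (C + C') => n.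
by rewrite big_split lerD.
Qed.

Lemma bounded_sumsZ (s : R) a :
  0 <= s -> bounded_sums a -> bounded_sums (fun k => s * a k).
Proof.
by move=> s0 [C bC]; exists (s * C) => n; rewrite -mulr_sumr ler_wpM2l.
Qed.

Lemma bounded_sums_cvg a :
  (forall k, 0 <= a k) -> bounded_sums a -> cvgn (series a).
Proof.
move=> a0 [C bC]; apply: nondecreasing_is_cvgn.
  by apply: nondecreasing_series => n _ _.
by exists C => _ [n _ <-]; exact: bC.
Qed.

Lemma sum_nat_addn p n a :
  \sum_(0 <= k < p + n) a k = \sum_(0 <= k < p) a k + \sum_(0 <= k < n) a (p + k)%N.
Proof.
elim: n => [|n IH]; first by rewrite addn0 [X in _ = _ + X]big_nil addr0.
by rewrite addnS big_nat_recr//= IH -addrA -big_nat_recr.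
Qed.

Lemma bounded_sums_shift p a :
  (forall k, 0 <= a k) -> bounded_sums (fun k => a (p + k)%N) -> bounded_sums a.
Proof.
move=> a0 [C bC]; exists (\sum_(0 <= k < p) a k + C) => n.
apply: (@le_trans _ _ (\sum_(0 <= k < p + n) a k)).
  by rewrite addnC sum_nat_addn lerDl sumr_ge0.
by rewrite sum_nat_addn lerD2l.
Qed.

Definition l2 m f : Prop := bounded_sums (fun x => f x ^+ 2 * m x).

Lemma l2_lin m (s : R) f g : (forall x, 0 < m x) ->
  l2 m f -> l2 m g -> l2 m (fun x => s * f x + g x).
Proof.
move=> m0 lf lg.
apply: (@bounded_sums_le _
  (fun x => (2 * s ^+ 2) * (f x ^+ 2 * m x) + 2 * (g x ^+ 2 * m x))).
  move=> x; rewrite mulrA mulrA -mulrDl ler_pM2r//.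
  have := sqr_ge0 (s * f x - g x); nra.
apply: bounded_sumsD; apply: bounded_sumsZ => //.
by have := sqr_ge0 s; lra.
Qed.

End BoundedSums.

(** * The resolvent equation in flux form and its maximum principles *)

Section Resolvent.
Context {R : realType} (m c : nat -> R) (eps : R).
Hypotheses (m0 : forall x, 0 < m x) (c0 : forall r, 0 < c r) (eps0 : 0 < eps).
Implicit Types (f g : nat -> R).

(** Stands for [g + eps L g = f], with [L] the Neumann Laplacian. The flux
    equation is the equation tested with the indicator of [{0, ..., r}]; it
    determines [L] up to the boundary condition at infinity. The last field
    is that condition, the equation tested with 1. When the mass is
    infinite, membership in l^2 takes its place. *)
Record resolves f g : Prop := Resolves {
  resolves_l2l : l2 m f;
  resolves_l2r : l2 m g;
  resolves_flux : forall r,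
    c r * (g r.+1 - g r) = eps^-1 * \sum_(0 <= j < r.+1) m j * (g j - f j);
  resolves_noflux : bounded_sums m ->
    (\sum_(0 <= j < n) m j * (g j - f j)) @[n --> \oo] --> (0 : R) }.

Lemma resolves_lin (s : R) f g f' g' : resolves f g -> resolves f' g' ->
  resolves (fun x => s * f x + f' x) (fun x => s * g x + g' x).
Proof.
move=> fg fg'.
have sumE n : \sum_(0 <= j < n) m j * (s * g j + g' j - (s * f j + f' j)) =
    s * \sum_(0 <= j < n) m j * (g j - f j) + \sum_(0 <= j < n) m j * (g' j - f' j).
  by rewrite mulr_sumr -big_split/=; apply: eq_bigr => j _; ring.
split.
- by apply: l2_lin => //; [case: fg|case: fg'].
- by apply: l2_lin => //; [case: fg|case: fg'].
- move=> r; rewrite sumE [RHS]mulrDr [X in _ = X + _]mulrCA.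
  by rewrite -(resolves_flux fg) -(resolves_flux fg'); ring.
- move=> bm; under eq_fun do rewrite sumE.
  have := cvgD (cvgM (cvg_cst s) (resolves_noflux fg bm)) (resolves_noflux fg' bm).
  rewrite mulr0 addr0 => H; exact: H.
Qed.

Lemma resolves0 : resolves (fun=> 0) (fun=> 0).
Proof.
have z n : \sum_(0 <= j < n) m j * (0 - 0 : R) = 0.
  by rewrite big1// => j _; rewrite subrr mulr0.
split.
- by exists 0 => n; rewrite big1// => j _; rewrite expr0n mul0r.
- by exists 0 => n; rewrite big1// => j _; rewrite expr0n mul0r.
- by move=> r; rewrite z subrr !mulr0.
- by move=> _; under eq_fun do rewrite z; exact: cvg_cst.
Qed.

Lemma resolvesZ (s : R) f g :
  resolves f g -> resolves (fun x => s * f x) (fun x => s * g x).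
Proof.
move=> fg; have := resolves_lin s fg resolves0.
by under eq_fun do rewrite addr0; under [X in resolves _ X]eq_fun do rewrite addr0.
Qed.

Lemma flux_gt0 f g r : resolves f g ->
  (g r < g r.+1) = (0 < \sum_(0 <= j < r.+1) m j * (g j - f j)).
Proof.
move=> fg; rewrite -subr_gt0 -(pmulr_rgt0 _ (c0 r)) (resolves_flux fg).
by rewrite pmulr_rgt0// invr_gt0.
Qed.

Lemma flux_le0 f g r : resolves f g ->
  (g r.+1 <= g r) = (\sum_(0 <= j < r.+1) m j * (g j - f j) <= 0).
Proof. by move=> fg; rewrite !leNgt (flux_gt0 _ fg). Qed.

(** The common end of the maximum principles below: a violation at one
    vertex propagates along the half-line, so that [g - f] stays away from
    0. As [g - f] is in l^2 this forces a finite mass, and then the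
    accumulated flux, increasing from a nonnegative value, cannot tend to 0. *)
Lemma no_escape f g (d : R) p : resolves f g -> 0 < d ->
  (forall j, (p <= j)%N -> d <= g j - f j) ->
  0 <= \sum_(0 <= j < p) m j * (g j - f j) -> False.
Proof.
move=> fg d0 dP S0.
have l2d : l2 m (fun x => g x - f x).
  have := l2_lin (-1) m0 (resolves_l2l fg) (resolves_l2r fg).
  by under eq_fun do rewrite mulN1r addrC.
have mS : bounded_sums m.
  have m_ge0 k : 0 <= m k by exact: ltW.
  apply: (bounded_sums_shift (p := p)) => //.
  case: l2d => C bC; exists (C / d ^+ 2) => n.
  rewrite ler_pdivlMr ?exprn_gt0//; apply: le_trans (bC (p + n)%N).
  rewrite sum_nat_addn -[leLHS]add0r mulr_suml; apply: lerD.
    by apply: sumr_ge0 => k _; rewrite mulr_ge0 ?sqr_ge0.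
  apply: ler_sum => k _; rewrite mulrC ler_pM2r//.
  have dk := dP (p + k)%N (leq_addr _ _).
  by rewrite ler_pXn2r// nnegrE ltW// (lt_le_trans d0).
have /cvgrPdist_lt /(_ (m p * d)) := resolves_noflux fg mS.
case; first by rewrite mulr_gt0.
move=> N _ /(_ (p.+1 + N)%N) /=; rewrite leq_addl => /(_ isT).
rewrite sub0r normrN; apply/negP; rewrite -leNgt.
rewrite addSnnS sum_nat_addn [X in _ + X]big_ltn// addn0 (le_trans _ (ler_norm _))//.
rewrite -[leLHS]add0r lerD// -[leLHS]addr0 lerD ?ler_pM2l//; first exact: dP.
apply: sumr_ge0 => j _; rewrite mulr_ge0 ?ltW//.
exact: lt_le_trans d0 (dP _ (leq_addr _ _)).
Qed.

(** At the first vertex where [g] is negative the flux is nonpositive, so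
    [g] keeps decreasing from there on. *)
Lemma resolves_ge0 f g : resolves f g -> (forall x, 0 <= f x) -> forall x, 0 <= g x.
Proof.
move=> fg f0 y; rewrite leNgt; apply/negP => gy.
have /ex_minnP[x gx xmin] : exists x, g x < 0 by exists y.
have S0 : \sum_(0 <= j < x) m j * (g j - f j) <= 0.
  case: x gx xmin => [|x] gx xmin; first by rewrite big_nil.
  rewrite -(flux_le0 x fg) (le_trans (ltW gx))// leNgt.
  by apply/negP => /xmin; rewrite ltnn.
have H i : g (x + i)%N <= g x /\ \sum_(0 <= j < x + i) m j * (g j - f j) <= 0.
  elim: i => [|i [gi Si]]; first by rewrite addn0.
  have Si1 : \sum_(0 <= j < x + i.+1) m j * (g j - f j) <= 0.
    rewrite addnS big_nat_recr//=.
    have := f0 (x + i)%N; have := m0 (x + i); nra.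
  split=> //; rewrite addnS; apply: le_trans gi.
  by rewrite (flux_le0 _ fg) -addnS.
apply: (@no_escape (fun j => -1 * f j) (fun j => -1 * g j) (- g x) x).
- exact: resolvesZ.
- by rewrite oppr_gt0.
- move=> j xj; have [+ _] := H (j - x)%N; rewrite subnKC//.
  by have := f0 j; lra.
- rewrite -oppr_le0 -sumrN (le_trans _ S0)// le_eqVlt; apply/orP; left.
  by apply/eqP/eq_bigr => j _; ring.
Qed.

Lemma resolves_le f g f' g' : resolves f g -> resolves f' g' ->
  (forall x, f x <= f' x) -> forall x, g x <= g' x.
Proof.
move=> fg fg' le_ff' x; suff : 0 <= -1 * g x + g' x by lra.
apply: (resolves_ge0 (resolves_lin (-1) fg fg')) => y /=.
by have := le_ff' y; lra.
Qed.

(** At the first vertex [p] where [g] increases, [g p > f p]. As [f] does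
    not increase, [g] and the flux keep growing from there on. *)
Lemma resolves_nonincreasing f g : resolves f g ->
  (forall x, f x.+1 <= f x) -> forall x, g x.+1 <= g x.
Proof.
move=> fg fdec y; rewrite leNgt; apply/negP => gy.
have /ex_minnP[p gp pmin] : exists x, g x < g x.+1 by exists y.
have Sp : \sum_(0 <= j < p) m j * (g j - f j) <= 0.
  case: p gp pmin => [|q] gp pmin; first by rewrite big_nil.
  rewrite -(flux_le0 q fg) leNgt.
  by apply/negP => /pmin; rewrite ltnn.
have Sp1 := gp; rewrite (flux_gt0 _ fg) big_nat_recr//= in Sp1.
have d0 : 0 < g p - f p by rewrite -(pmulr_rgt0 _ (m0 p)); lra.
have H i : g p - f p <= g (p + i)%N - f (p + i)%N /\
    0 < \sum_(0 <= j < (p + i).+1) m j * (g j - f j).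
  elim: i => [|i [gi Si]]; first by rewrite addn0 big_nat_recr.
  have gi1 : g (p + i)%N < g (p + i).+1 by rewrite (flux_gt0 _ fg).
  have di1 : g p - f p <= g (p + i.+1)%N - f (p + i.+1)%N.
    by rewrite addnS; have := fdec (p + i)%N; lra.
  split=> //; rewrite big_nat_recr//= addr_gt0// ?addnS//.
  by rewrite mulr_gt0// -addnS (lt_le_trans d0).
apply: (@no_escape f g _ p.+1 fg d0).
- move=> j /ltnW pj; have [+ _] := H (j - p)%N; rewrite subnKC//.
- by have [_ +] := H 0%N; rewrite addn0 => /ltW.
Qed.

End Resolvent.

(** * Iterated resolvents and their decay at infinity *)

Section ResolventChains.
Context {R : realType} (m c : nat -> R).
Hypotheses (m0 : forall x, 0 < m x) (c0 : forall r, 0 < c r).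
Implicit Types (f g h : nat -> R) (G : nat -> nat -> R).

Definition ball_ind (N : nat) : nat -> R := fun x => (x <= N)%:R.

(** A truncation of the series of the [m(B_r^c) / c r] that is finite even
    if the mass is not. *)
Definition tail_sum (N K : nat) : R :=
  \sum_(N <= r < K) (\sum_(r.+1 <= k < K.+1) m k) / c r.

Definition resolvent_iterates (eps : R) f G : Prop :=
  G 0%N = f /\ forall k, resolves m c eps (G k) (G k.+1).

Lemma iterates_le eps f f' G G' : 0 < eps ->
  resolvent_iterates eps f G -> resolvent_iterates eps f' G' ->
  (forall x, f x <= f' x) -> forall k x, G k x <= G' k x.
Proof.
move=> e0 [G0 GS] [G'0 G'S] ff'; elim=> [x|k IH]; first by rewrite G0 G'0.
exact (resolves_le m0 c0 e0 (GS k) (G'S k) IH).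
Qed.

Lemma iterates_ge0 eps f G : 0 < eps ->
  resolvent_iterates eps f G -> (forall x, 0 <= f x) -> forall k x, 0 <= G k x.
Proof.
move=> e0 [G0 GS] f0; elim=> [x|k IH]; first by rewrite G0.
exact (resolves_ge0 m0 c0 e0 (GS k) IH).
Qed.

Lemma iterates_nonincreasing eps f G : 0 < eps ->
  resolvent_iterates eps f G -> (forall x, f x.+1 <= f x) ->
  forall k x, G k x.+1 <= G k x.
Proof.
move=> e0 [G0 GS] f0; elim=> [x|k IH]; first by rewrite G0.
exact (resolves_nonincreasing m0 c0 e0 (GS k) IH).
Qed.

(** By monotonicity only the value at 0 matters, and there the flux equation
    says that a nonincreasing solution does not exceed the right-hand side. *)
Lemma iterates_le1 eps f G : 0 < eps ->
  resolvent_iterates eps f G -> (forall x, f x.+1 <= f x) ->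
  f 0%N <= 1 -> forall k x, G k x <= 1.
Proof.
move=> e0 iG fdec f1 k x; have Gdec := iterates_nonincreasing e0 iG fdec.
apply: (@le_trans _ _ (G k 0%N)).
  by elim: x => // x; exact: le_trans (Gdec k x).
case: iG => G0 GS; elim: k => [|k IH]; first by rewrite G0.
apply: le_trans IH; rewrite -subr_le0 -(pmulr_rle0 _ (m0 0%N)).
have := Gdec k.+1 0%N; rewrite (flux_le0 c0 e0 _ (GS k)).
by rewrite big_nat1.
Qed.

Lemma ball_ind_ge0 N x : 0 <= ball_ind N x. Proof. exact: ler0n. Qed.

Lemma ball_ind_nonincreasing N x : ball_ind N x.+1 <= ball_ind N x.
Proof. by rewrite /ball_ind; case: ltnP => [/ltnW ->|_]. Qed.

(** A discrete form of [L int_0^t P_s f ds = f - P_t f]. *)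
Lemma summed_flux eps f G n r : 0 < eps -> resolvent_iterates eps f G ->
  c r * (eps * \sum_(0 <= k < n) (G k.+1 r - G k.+1 r.+1)) =
  \sum_(0 <= j < r.+1) m j * (f j - G n j).
Proof.
move=> e0 [<- GS]; elim: n => [|n IH].
  by rewrite big_nil !mulr0 big1// => j _; rewrite subrr mulr0.
rewrite big_nat_recr//= mulrDr mulrDr {}IH.
have -> : c r * (eps * (G n.+1 r - G n.+1 r.+1)) =
    - (eps * (c r * (G n.+1 r.+1 - G n.+1 r))) by ring.
rewrite (resolves_flux (GS n)) mulrA divff ?gt_eqF// mul1r -sumrN -big_split/=.
by apply: eq_bigr => j _; ring.
Qed.

(** The sum [Ga] over time of the iterates is nonincreasing in space and at
    most [n * eps]. Its flux through the edge [(r, r + 1)] exceeds the one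
    through [(K, K + 1)], which is nonnegative, by the mass of the [n]-th
    iterate on [{r+1, ..., K}], and this is at least the value at [K] times
    [m({r+1, ..., K})]. *)
Lemma iterates_decay eps N G n K : 0 < eps ->
  resolvent_iterates eps (ball_ind N) G -> (N <= K)%N ->
  G n K * tail_sum N K <= n%:R * eps.
Proof.
move=> e0 iG NK.
have G0 := iterates_ge0 e0 iG (ball_ind_ge0 N).
have Gdec := iterates_nonincreasing e0 iG (ball_ind_nonincreasing N).
have G1 := iterates_le1 e0 iG (ball_ind_nonincreasing N) (lexx _).
have GK j : (j <= K)%N -> G n K <= G n j.
  move=> jK; rewrite -(subnKC jK); elim: (K - j)%N => [|i IH]; first by rewrite addn0.
  by rewrite addnS (le_trans (Gdec _ _)).
pose Ga r := eps * \sum_(0 <= k < n) G k.+1 r.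
have Ga0 r : 0 <= Ga r by apply: mulr_ge0; [exact: ltW|apply: sumr_ge0].
have flux r : c r * (Ga r - Ga r.+1) = \sum_(0 <= j < r.+1) m j * (ball_ind N j - G n j).
  by rewrite -(summed_flux n r e0 iG) /Ga -mulrBr -sumrB.
have step r : (N <= r < K)%N ->
    G n K * ((\sum_(r.+1 <= k < K.+1) m k) / c r) <= Ga r - Ga r.+1.
  move=> /andP[Nr rK]; rewrite mulrA ler_pdivrMr// [leRHS]mulrC flux.
  have := flux K; rewrite (@big_cat_nat _ _ _ r.+1 0 K.+1)//= 1?ltnS 1?ltnW//.
  have : 0 <= c K * (Ga K - Ga K.+1).
    apply: mulr_ge0; first exact: ltW.
    by rewrite subr_ge0 ler_pM2l//; apply: ler_sum => k _; exact: Gdec.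
  have -> : \sum_(r.+1 <= i < K.+1) m i * (ball_ind N i - G n i) =
            - \sum_(r.+1 <= i < K.+1) m i * G n i.
    rewrite -sumrN big_nat_cond [RHS]big_nat_cond; apply: eq_bigr => i.
    rewrite andbT => /andP[ri _].
    by rewrite /ball_ind leqNgt (leq_ltn_trans Nr ri) sub0r mulrN.
  have : G n K * (\sum_(r.+1 <= k < K.+1) m k) <= \sum_(r.+1 <= i < K.+1) m i * G n i.
    rewrite mulr_sumr big_nat_cond [leRHS]big_nat_cond; apply: ler_sum => i.
    by rewrite andbT => /andP[ri iK]; rewrite mulrC ler_pM2l// GK.
  by lra.
rewrite mulr_sumr; apply: (@le_trans _ _ (Ga N - Ga K)).
  have -> : Ga N - Ga K = \sum_(N <= r < K) (Ga r - Ga r.+1).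
    by rewrite -[LHS]opprB -telescope_sumr// -sumrN; apply: eq_bigr => r _; rewrite opprB.
  rewrite big_nat_cond [leRHS]big_nat_cond; apply: ler_sum => r.
  by rewrite andbT; exact: step.
have : Ga N <= n%:R * eps.
  rewrite mulrC ler_pM2l// (@le_trans _ _ (\sum_(0 <= k < n) 1))//.
    by apply: ler_sum => k _.
  by rewrite sumr_const_nat subn0.
by have := Ga0 K; lra.
Qed.

End ResolventChains.

(** * Tails of a finite measure *)

Section TailMass.
Context {R : realType} (m : nat -> R).
Hypotheses (m0 : forall x, 0 < m x) (bm : bounded_sums m).

(** The measure of [{r+1, r+2, ...}], for [m] of finite mass. *)
Definition tail_mass (r : nat) : R := limn (series m) - \sum_(0 <= j < r.+1) m j.

Lemma bounded_mass_cvg : cvgn (series m).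
Proof.
by apply: bounded_sums_cvg bm => k; exact: ltW.
Qed.

Lemma tail_mass_ge0 r : 0 <= tail_mass r.
Proof.
rewrite subr_ge0; apply: (nondecreasing_cvgn_le _ bounded_mass_cvg r.+1).
by apply: nondecreasing_series => n _ _; exact: ltW.
Qed.

Lemma tail_massS r : tail_mass r = m r.+1 + tail_mass r.+1.
Proof. by rewrite /tail_mass (big_nat_recr r.+1)//=; ring. Qed.

Lemma tail_mass_cvg0 : tail_mass r @[r --> \oo] --> 0.
Proof.
rewrite -(subrr (limn (series m))); apply: cvgB; first exact: cvg_cst.
by rewrite (cvg_shiftS (series m)); exact: bounded_mass_cvg.
Qed.

Lemma inner_tail_cvg r :
  \sum_(r.+1 <= k < K.+1) m k @[K --> \oo] --> tail_mass r.
Proof.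
have : series m K.+1 - series m r.+1 @[K --> \oo] --> tail_mass r.
  apply: cvgB; last exact: cvg_cst.
  by rewrite (cvg_shiftS (series m)); exact: bounded_mass_cvg.
apply: cvg_trans; apply: near_eq_cvg; exists r => // K /= rK.
by rewrite /series/= (@big_cat_nat _ _ _ r.+1 0 K.+1)//= addrAC subrr add0r.
Qed.

Lemma inner_tail_le r K : \sum_(r.+1 <= k < K.+1) m k <= tail_mass r.
Proof.
have [rK|Kr] := leqP r K; last by rewrite big_geq ?tail_mass_ge0// ltnW.
rewrite /tail_mass lerBrDl -(@big_cat_nat _ _ _ r.+1 0 K.+1)//=.
apply: (nondecreasing_cvgn_le _ bounded_mass_cvg K.+1).
by apply: nondecreasing_series => n _ _; exact: ltW.
Qed.

End TailMass.

(** * A lower bound when infinity is an entrance boundary *)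

Section EntranceAtInfinity.
Context {R : realType} (m c : nat -> R).
Hypotheses (m0 : forall x, 0 < m x) (c0 : forall r, 0 < c r).
Implicit Types (f g h : nat -> R) (G : nat -> nat -> R).

(** Convergence of the series of the [m(B_r^c) / c r]. In the terminology of
    Feller, infinity is then an entrance or a regular boundary. *)
Definition entrance_at_infinity : Prop :=
  exists C : R, forall K, tail_sum m c 0 K <= C.

Lemma inner_tail_ge0 r K : 0 <= (\sum_(r.+1 <= k < K.+1) m k) / c r.
Proof. by rewrite divr_ge0 ?(ltW (c0 _))// sumr_ge0// => k _; exact: ltW. Qed.

(** The first term of the sum alone bounds the mass. *)
Lemma tail_sum_bounded_mass N :
  (exists C, forall K, tail_sum m c N K <= C) -> bounded_sums m.
Proof.
move=> [C bC]; have C0 : 0 <= C.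
  by apply: le_trans (bC 0%N); rewrite /tail_sum big_geq.
apply: (@bounded_sums_shift _ N.+1 m) => [k|]; first exact: ltW.
exists (C * c N) => -[|n]; first by rewrite big_nil mulr_ge0// ltW.
rewrite -ler_pdivrMr//; apply: le_trans (bC (N.+1 + n)%N).
rewrite /tail_sum [leRHS]big_ltn ?leq_addr// -[leLHS]addr0 lerD//; last first.
  by apply: sumr_ge0 => r _; exact: inner_tail_ge0.
rewrite le_eqVlt; apply/orP; left; apply/eqP; congr (_ / _).
have := sum_nat_addn N.+1 n.+1 m; rewrite addnS.
rewrite (@big_cat_nat _ _ _ N.+1 0 (N.+1 + n).+1)//=; last by rewrite ltnS leqW// leq_addr.
by move/addrI => <-.
Qed.

Lemma entrance_bounded_mass : entrance_at_infinity -> bounded_sums m.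
Proof. exact: tail_sum_bounded_mass. Qed.

(** The starting index is irrelevant for convergence: the mass being finite,
    each omitted term stays bounded as [K] grows. *)
Lemma tail_sum_bounded_entrance N :
  (exists C, forall K, tail_sum m c N K <= C) -> entrance_at_infinity.
Proof.
move=> bt; have [M bM] := tail_sum_bounded_mass bt; case: bt => C bC.
have C0 : 0 <= C by apply: le_trans (bC 0%N); rewrite /tail_sum big_geq.
have term0 := inner_tail_ge0.
exists (\sum_(0 <= r < N) M / c r + C) => K.
have part r : (\sum_(r.+1 <= k < K.+1) m k) / c r <= M / c r.
  rewrite ler_wpM2r ?invr_ge0 ?(ltW (c0 _))//.
  have [rK|Kr] := leqP r K; last first.
    by rewrite big_geq ?(leq_trans Kr)// (le_trans _ (bM 0%N))// big_nil.
  apply: le_trans (bM K.+1); rewrite (@big_cat_nat _ _ _ r.+1 0 K.+1)//= lerDr.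
  by apply: sumr_ge0 => k _; exact: ltW.
have [NK|KN] := leqP N K.
  rewrite /tail_sum (@big_cat_nat _ _ _ N 0 K)//= lerD//; last exact: bC.
  by apply: ler_sum => r _.
rewrite -[leLHS]addr0 lerD// (@big_cat_nat _ _ _ K 0 N)//= ?(ltnW KN)//.
rewrite -[leLHS]addr0 lerD//; first by apply: ler_sum => r _.
apply: sumr_ge0 => r _; apply: le_trans (part r) => //.
Qed.

Hypothesis entr : entrance_at_infinity.

Let bm : bounded_sums m := entrance_bounded_mass entr.
Let tail_ge0 r : 0 <= tail_mass m r := tail_mass_ge0 m0 bm r.

Lemma entrance_tail_bounded : bounded_sums (fun r => tail_mass m r / c r).
Proof.
case: entr => C bC; exists C => n.
have cvgn_sum : \sum_(0 <= r < n) (\sum_(r.+1 <= k < K.+1) m k) / c r @[K --> \oo]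
    --> \sum_(0 <= r < n) tail_mass m r / c r.
  elim: n => [|n IH].
    by rewrite big_nil; under eq_fun do rewrite big_nil; exact: cvg_cst.
  rewrite big_nat_recr//=; under eq_fun do rewrite big_nat_recr//=.
  apply: cvgD => //; apply: cvgM; last exact: cvg_cst.
  exact: inner_tail_cvg.
apply: (cvgr_to_le cvgn_sum); exists n => // K /= nK.
apply: le_trans (bC K); rewrite /tail_sum (@big_cat_nat _ _ _ n 0 K)//= lerDl.
by apply: sumr_ge0 => r _; exact: inner_tail_ge0.
Qed.

Lemma entrance_tail_small (e : R) : 0 < e ->
  exists N, forall x, \sum_(N <= r < x) tail_mass m r / c r <= e.
Proof.
move=> e0; set T := fun r => tail_mass m r / c r.
have T0 r : 0 <= T r by rewrite divr_ge0 ?tail_ge0 ?ltW.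
have cT := bounded_sums_cvg T0 entrance_tail_bounded.
have /cvgrPdist_lt /(_ e e0) [N _ /(_ N (leqnn N)) /=] := cT.
move=> /(le_lt_trans (ler_norm _)) HN; exists N => x.
have [xN|/ltnW Nx] := leqP x N; first by rewrite big_geq ?ltW.
have : series T x <= limn (series T).
  by apply: nondecreasing_cvgn_le => //; apply: nondecreasing_series => n _ _.
rewrite /series/= in HN *; rewrite (@big_cat_nat _ _ _ N 0 x)//=.
by rewrite /T in HN *; lra.
Qed.

(** The mean time to reach [N] from [x]; it is 0 for [x <= N]. *)
Definition hitting_time (N x : nat) : R := \sum_(N <= r < x) tail_mass m r / c r.

(** The Laplacian of the hitting time: 1 beyond [N], as for every mean
    hitting time, and a negative value at [N] that makes the total mass of
    this function zero. *)
Definition hitting_source (N x : nat) : R :=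
  if (x < N)%N then 0 else if x == N then - (tail_mass m N / m N) else 1.

Lemma hitting_time_ge0 N x : 0 <= hitting_time N x.
Proof. by apply: sumr_ge0 => r _; rewrite divr_ge0 ?tail_ge0 ?ltW. Qed.

Lemma sum_hitting_source N r :
  \sum_(0 <= j < r.+1) m j * hitting_source N j =
  if (r < N)%N then 0 else - tail_mass m r.
Proof.
elim: r => [|r IH].
  rewrite big_nat1 /hitting_source; case: ltnP => [_|]; first by rewrite mulr0.
  by rewrite leqn0 => /eqP ->; rewrite eqxx mulrN mulrC divfK ?gt_eqF.
rewrite big_nat_recr//= {}IH /hitting_source.
case: (ltngtP r.+1 N) => rN.
- by rewrite mulr0 addr0.
- by rewrite mulr1 (tail_massS m r); ring.
- by rewrite rN add0r mulrN mulrC divfK ?gt_eqF.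
Qed.

Lemma hitting_time_resolves (eps e : R) N : 0 < eps ->
  (forall x, hitting_time N x <= e) ->
  resolves m c eps (fun x => eps * hitting_source N x + hitting_time N x)
    (hitting_time N).
Proof.
move=> eps0 he.
have lh : l2 m (hitting_time N).
  apply: (bounded_sums_le (a' := fun x => e ^+ 2 * m x)) => [x|].
    rewrite ler_pM2r// ler_pXn2r// ?nnegrE ?hitting_time_ge0//.
    by rewrite (le_trans (hitting_time_ge0 N x)).
  by apply: bounded_sumsZ => //; exact: sqr_ge0.
have ls : l2 m (hitting_source N).
  apply: (bounded_sums_le (a' := fun x => (1 + (tail_mass m N / m N) ^+ 2) * m x)) => [x|].
    rewrite ler_pM2r// /hitting_source; have := sqr_ge0 (tail_mass m N / m N).
    by case: ifP => _; [|case: ifP => _]; rewrite ?sqrrN; lra.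
  by apply: bounded_sumsZ => //; have := sqr_ge0 (tail_mass m N / m N); lra.
have sumE r : \sum_(0 <= j < r.+1)
    m j * (hitting_time N j - (eps * hitting_source N j + hitting_time N j)) =
    - eps * (if (r < N)%N then 0 else - tail_mass m r).
  by rewrite -sum_hitting_source mulr_sumr; apply: eq_bigr => j _; ring.
split=> //.
- exact: l2_lin.
- move=> r; rewrite sumE mulrA mulrN mulVf ?gt_eqF// mulN1r.
  case: ltnP => rN; first by rewrite /hitting_time !big_geq ?(ltnW rN)// subrr mulr0 oppr0.
  rewrite /hitting_time big_nat_recr//= [X in X - _]addrC addrK opprK.
  by rewrite mulrC divfK ?gt_eqF.
- move=> _; rewrite -cvg_shiftS /=; under eq_fun do rewrite sumE.
  have H : eps * tail_mass m r @[r --> \oo] --> eps * 0.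
    by apply: cvgM; [exact: cvg_cst|exact: (tail_mass_cvg0 m0 bm)].
  rewrite mulr0 in H.
  apply: cvg_trans H; apply: near_eq_cvg; exists N => // r /= Nr.
  by rewrite ltnNge Nr/= mulrNN.
Qed.

Lemma resolves1 (eps : R) : 0 < eps -> resolves m c eps (fun=> 1) (fun=> 1).
Proof.
move=> eps0.
have l1 : l2 m (fun=> 1).
  by apply: bounded_sums_le bm => k; rewrite expr1n mul1r.
have z n : \sum_(0 <= j < n) m j * (1 - 1 : R) = 0.
  by rewrite big1// => j _; rewrite subrr mulr0.
split=> //.
- by move=> r; rewrite z subrr !mulr0.
- by move=> _; under eq_fun do rewrite z; exact: cvg_cst.
Qed.

Lemma resolves_sum (eps : R) G n : 0 < eps ->
  (forall k, resolves m c eps (G k) (G k.+1)) ->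
  resolves m c eps (fun x => \sum_(0 <= k < n) G k x) (fun x => \sum_(0 <= k < n) G k.+1 x).
Proof.
move=> eps0 GS; elim: n => [|n IH].
  under eq_fun do rewrite big_nil.
  by under [X in resolves _ _ _ _ X]eq_fun do rewrite big_nil; exact: resolves0.
have := resolves_lin m0 1 (GS n) IH.
under eq_fun do rewrite mul1r addrC -big_nat_recr//=.
under [X in resolves _ _ _ _ X]eq_fun => x.
  rewrite mul1r addrC -(big_nat_recr n 0 (fun k => G k.+1 x))//=; over.
by [].
Qed.

(** A discrete form of [h >= h - P_t h = int_0^t P_s L h ds], in which [L h
    >= 1 - kappa * ball_ind N] for the factor [kappa] of the statement. It
    is proved by induction on the number of steps, comparing the left-hand
    side with [h] by the maximum principle. *)
Lemma hitting_time_bound (eps e : R) N G n x : 0 < eps ->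
  resolvent_iterates m c eps (ball_ind N) G ->
  (forall x, hitting_time N x <= e) ->
  n%:R * eps - (1 + tail_mass m N / m N) * (eps * \sum_(0 <= k < n) G k.+1 x) <= e.
Proof.
move=> eps0 [G0 GS] he; apply: le_trans (he x).
set L := 1 + _.
(* [V] is the left-hand side of the claim; one resolvent step maps [V n +
   eps * (1 - L * ball_ind N)] to [V n.+1]. *)
pose V n x := n%:R * eps - L * (eps * \sum_(0 <= k < n) G k.+1 x).
rewrite -/(V n x); elim: n x => [|n IH] x.
  by rewrite /V big_nil !mulr0 mul0r subrr hitting_time_ge0.
have rV : resolves m c eps
    (fun x => n.+1%:R * eps * 1 + - (L * eps) * \sum_(0 <= k < n.+1) G k x)
    (fun x => n.+1%:R * eps * 1 + - (L * eps) * \sum_(0 <= k < n.+1) G k.+1 x).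
  have := resolvesZ m0 (- (L * eps)) (resolves_sum n.+1 eps0 GS).
  exact: (resolves_lin m0 _ (resolves1 eps0)).
have key y : n.+1%:R * eps * 1 + - (L * eps) * (\sum_(0 <= k < n.+1) G k y) <=
    eps * hitting_source N y + hitting_time N y.
  have -> : n.+1%:R * eps * 1 + - (L * eps) * (\sum_(0 <= k < n.+1) G k y) =
      V n y + eps * (1 - L * ball_ind N y).
    by rewrite /V big_nat_recl//= G0 -natr1; ring.
  rewrite [leRHS]addrC lerD// ler_pM2l// /ball_ind /hitting_source /L.
  have TN : 0 <= tail_mass m N / m N by rewrite divr_ge0 ?tail_ge0 ?ltW.
  by case: ltngtP => _ /=; lra.
have -> : V n.+1 x = n.+1%:R * eps * 1 + - (L * eps) * \sum_(0 <= k < n.+1) G k.+1 x.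
  by rewrite /V; ring.
exact (resolves_le m0 c0 eps0 rV (hitting_time_resolves eps0 he) key x).
Qed.

Definition jump_rate (x : nat) : R :=
  (c x + if x is y.+1 then c y else 0) / m x.

(** Dropping the inflow from the neighbours: in one step of length [eps] a
    vertex loses at most the proportion given by its total jump rate. *)
Lemma resolves_jump_rate (eps : R) f g x : 0 < eps -> resolves m c eps f g ->
  (forall x, 0 <= f x) -> f x <= (1 + eps * jump_rate x) * g x.
Proof.
move=> eps0 fg f0; have g0 := resolves_ge0 m0 c0 eps0 fg f0.
have key : f x - g x <= eps * jump_rate x * g x.
  rewrite -(ler_pM2l (m0 x)).
  have -> : m x * (eps * jump_rate x * g x) =
      eps * ((c x + if x is y.+1 then c y else 0) * g x).
    by rewrite /jump_rate; field; rewrite gt_eqF.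
  have F0 := resolves_flux fg x; rewrite big_nat_recr//= [RHS]mulrDr in F0.
  have E : m x * (f x - g x) = eps * (eps^-1 * (m x * (f x - g x))).
    by rewrite mulrA divff ?mul1r// gt_eqF.
  rewrite E ler_pM2l//; clear E.
  have -> : eps^-1 * (m x * (f x - g x)) = - (eps^-1 * (m x * (g x - f x))) by ring.
  have a1 : 0 <= c x * g x.+1 by rewrite mulr_ge0// ltW.
  case: x F0 a1 => [|y] F0 a1.
    by rewrite big_nil mulr0 add0r in F0; rewrite -F0; lra.
  rewrite -(resolves_flux fg y) in F0.
  have a2 : 0 <= c y * g y by rewrite mulr_ge0// ltW.
  by move: F0 a1 a2; nra.
by lra.
Qed.

Lemma iterates_jump_rate (eps d : R) N G : 0 < eps ->
  resolvent_iterates m c eps (ball_ind N) G ->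
  (forall x, (x <= N)%N -> jump_rate x <= d) -> 0 <= d ->
  forall j x, (1 + eps * d) ^- j * ball_ind N x <= G j x.
Proof.
move=> eps0 iG dP d0 j x.
have G0 := iterates_ge0 m0 c0 eps0 iG (ball_ind_ge0 N).
have d1 : 0 < 1 + eps * d by rewrite ltr_wpDr// mulr_ge0// ltW.
have [xN|Nx] := leqP x N; last by rewrite /ball_ind leqNgt Nx mulr0.
elim: j => [|j IH].
  by case: iG => -> _; rewrite expr0 invr1 mul1r.
case: iG => _ GS; have := resolves_jump_rate x eps0 (GS j) (G0 j).
rewrite exprS invfM -mulrA ler_pdivrMl// => /(le_trans IH) /le_trans; apply.
by rewrite ler_wpM2r// lerD2l ler_pM2l// dP.
Qed.

(** The ball retains the proportion [(1 + eps * d) ^- j] of itself in [j]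
    steps, and the remaining [k] steps preserve the order. This bounds an
    earlier iterate by a later one, at all vertices simultaneously. *)
Lemma iterates_almost_monotone (eps d : R) N G : 0 < eps ->
  resolvent_iterates m c eps (ball_ind N) G ->
  (forall x, (x <= N)%N -> jump_rate x <= d) -> 0 <= d ->
  forall j k x, (1 + eps * d) ^- j * G k x <= G (j + k)%N x.
Proof.
move=> eps0 iG dP d0 j k x.
have iGj : resolvent_iterates m c eps (G j) (fun k => G (j + k)%N).
  by case: iG => _ GS; split=> [|i]; rewrite ?addn0// addnS.
have iGs : resolvent_iterates m c eps (fun x => (1 + eps * d) ^- j * ball_ind N x)
    (fun k x => (1 + eps * d) ^- j * G k x).
  by case: iG => G0 GS; split=> [|i]; [rewrite G0|exact: resolvesZ].
apply: (iterates_le m0 c0 eps0 iGs iGj) => y.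
exact: iterates_jump_rate.
Qed.

(** With [N] so large that reaching the ball takes a mean time of at most [t
    / 2], the time spent in the ball up to [t] is bounded from below; by
    almost monotonicity in time, so is its last value. The bound does not
    depend on the number of steps. *)
Lemma entrance_iterates_lower_bound (t : R) : 0 < t ->
  exists N (d : R), 0 < d /\ forall n G, (0 < n)%N ->
    resolvent_iterates m c (t / n%:R) (ball_ind N) G -> forall x, d <= G n x.
Proof.
move=> t0; have [|N hN] := @entrance_tail_small (t / 2); first by lra.
pose d := \sum_(0 <= x < N.+1) jump_rate x.
have jr0 x : 0 <= jump_rate x.
  rewrite divr_ge0 ?(ltW (m0 _))// addr_ge0 ?(ltW (c0 _))//.
  by case: x => // x; exact: ltW.
have d0 : 0 <= d by apply: sumr_ge0.
have dP x : (x <= N)%N -> jump_rate x <= d.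
  move=> xN; rewrite /d (@big_cat_nat _ _ _ x 0 N.+1)//= 1?ltnW//.
  rewrite [X in _ + X]big_ltn ?ltnS// addrCA lerDl addr_ge0// sumr_ge0//.
have L0 : 0 < 1 + tail_mass m N / m N.
  by rewrite ltr_wpDr// divr_ge0 ?tail_ge0 ?ltW.
exists N, (expR (- (t * d)) / (2 * (1 + tail_mass m N / m N))).
split; first by rewrite divr_gt0 ?expR_gt0// mulr_gt0.
move=> n G n0 iG x; set eps := t / n%:R in iG.
have n0' : 0 < n%:R :> R by rewrite ltr0n.
have eps0 : 0 < eps by rewrite divr_gt0.
have G0 := iterates_ge0 m0 c0 eps0 iG (ball_ind_ge0 N).
have mono k : (k <= n)%N -> expR (- (t * d)) * G k x <= G n x.
  move=> kn; rewrite -{1}(subnK kn).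
  apply: le_trans (iterates_almost_monotone eps0 iG dP d0 _ _ _).
  apply: ler_wpM2r => //.
  have d1 : 0 < 1 + eps * d by rewrite ltr_wpDr// mulr_ge0// ltW.
  rewrite expRN lef_pV2 ?posrE ?expR_gt0 ?exprn_gt0//.
  apply: (@le_trans _ _ (expR (eps * d) ^+ (n - k))).
    by apply: lerXn2r; rewrite ?nnegrE ?expR_ge0 ?(ltW d1) ?expR_ge1Dx.
  rewrite -expRM_natl ler_expR mulrA ler_wpM2r// /eps mulrC -mulrA ler_piMr ?(ltW t0)//.
  by rewrite mulrC ler_pdivrMr// mul1r ler_nat leq_subr.
have := hitting_time_bound n x eps0 iG hN.
have -> : n%:R * eps = t by rewrite /eps mulrC divfK ?gt_eqF.
set L := 1 + _ in L0 *; set S := eps * _ => tS.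
have ES : expR (- (t * d)) * S <= t * G n x.
  rewrite /S mulrCA.
  have -> : t * G n x = eps * (n%:R * G n x) by rewrite mulrA /eps divfK ?gt_eqF.
  rewrite ler_pM2l// mulr_sumr.
  apply: (@le_trans _ _ (\sum_(0 <= k < n) G n x)).
    rewrite big_nat_cond [leRHS]big_nat_cond; apply: ler_sum => k.
    by rewrite andbT => /andP[_ kn]; exact: mono.
  by rewrite sumr_const_nat subn0 mulr_natl.
have E0 := expR_gt0 (- (t * d)); set E := expR _ in ES E0 *.
rewrite ler_pdivrMr ?mulr_gt0//.
rewrite -(ler_pM2l t0).
have : E * (t / 2) <= E * (L * S) by rewrite ler_pM2l//; lra.
have : L * (E * S) <= L * (t * G n x) by rewrite ler_pM2l.
by lra.
Qed.

End EntranceAtInfinity.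

(** * Harmonic functions *)

Section HarmonicFlux.
Context {R : realType} (m c : nat -> R).
Hypotheses (m0 : forall x, 0 < m x) (c0 : forall r, 0 < c r).
Implicit Types (u : nat -> R) (alpha : R).

(** The harmonic equation summed over [{0, ..., r}]. *)
Definition harmonic_flux alpha u : Prop := forall r,
  c r * (u r.+1 - u r) = alpha * \sum_(0 <= j < r.+1) m j * u j.

Lemma harmonic_flux_grows alpha u : 0 < alpha -> harmonic_flux alpha u -> 0 <= u 0%N ->
  forall x, u 0%N <= u x /\ m 0%N * u 0%N <= \sum_(0 <= j < x.+1) m j * u j.
Proof.
move=> a0 hu u0; elim=> [|x [ux Sx]]; first by rewrite big_nat1.
have u1 : u 0%N <= u x.+1.
  apply: le_trans ux _; rewrite -subr_ge0 -(pmulr_rge0 _ (c0 x)) hu.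
  rewrite mulr_ge0 ?(ltW a0)// (le_trans _ Sx)// mulr_ge0//; exact: ltW.
split=> //; rewrite big_nat_recr//= -[leLHS]addr0 lerD// mulr_ge0 ?(ltW (m0 _))//.
exact: le_trans u1.
Qed.

Lemma harmonic_fluxN alpha u :
  harmonic_flux alpha u -> harmonic_flux alpha (fun x => - u x).
Proof.
move=> hu r; rewrite -opprD mulrN hu -mulrN -sumrN; congr (_ * _).
by apply: eq_bigr => j _; rewrite mulrN.
Qed.

Lemma harmonic_flux_eq0 alpha u : 0 < alpha -> harmonic_flux alpha u ->
  u 0%N = 0 -> forall x, u x = 0.
Proof.
move=> a0 hu u0 x; apply/eqP; rewrite eq_le.
have [] := harmonic_flux_grows a0 (harmonic_fluxN hu) _ x.
  by rewrite u0 oppr0.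
have [] := harmonic_flux_grows a0 hu _ x; first by rewrite u0.
by rewrite u0; lra.
Qed.

(** Summation by parts, [u k] being the sum of [u 0] and of its increments,
    which the flux equation gives. *)
Lemma harmonic_mass alpha u K : harmonic_flux alpha u ->
  \sum_(0 <= k < K.+1) m k * u k = u 0%N * \sum_(0 <= k < K.+1) m k +
  alpha * \sum_(0 <= r < K)
    (\sum_(0 <= j < r.+1) m j * u j) * ((\sum_(r.+1 <= k < K.+1) m k) / c r).
Proof.
move=> hu.
have uE x : u x = u 0%N +
    alpha * \sum_(0 <= r < x) (\sum_(0 <= j < r.+1) m j * u j) / c r.
  elim: x => [|x IH]; first by rewrite big_nil mulr0 addr0.
  rewrite big_nat_recr//= mulrDr addrA -IH mulrA -hu.
  by rewrite mulrC mulrA mulVf ?gt_eqF// mul1r; ring.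
elim: K => [|K IH]; first by rewrite !big_nat1 big_nil mulr0 addr0 mulrC.
rewrite big_nat_recr//= IH (big_nat_recr K.+1 0 (fun k => m k))//= (uE K.+1).
set S := fun r => \sum_(0 <= j < r.+1) m j * u j.
have -> : \sum_(0 <= r < K.+1) S r * ((\sum_(r.+1 <= k < K.+2) m k) / c r) =
    \sum_(0 <= r < K.+1) S r * ((\sum_(r.+1 <= k < K.+1) m k) / c r) +
    m K.+1 * \sum_(0 <= r < K.+1) S r / c r.
  rewrite mulr_sumr -big_split/= big_nat_cond [RHS]big_nat_cond.
  apply: eq_bigr => r; rewrite andbT => /andP[_ rK].
  by rewrite (big_nat_recr K.+1 r.+1)//=; ring.
rewrite [X in _ + alpha * (X + _)]big_nat_recr//= (big_geq (leqnn _)).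
by ring.
Qed.

(** In [harmonic_mass] every partial sum is at least [m 0 * u 0]. *)
Lemma summable_harmonic_entrance alpha u : 0 < alpha -> harmonic_flux alpha u ->
  0 < u 0%N -> bounded_sums (fun x => m x * u x) -> entrance_at_infinity m c.
Proof.
move=> a0 hu u0 [C bC].
have H := harmonic_flux_grows a0 hu (ltW u0).
have mu0 : 0 < m 0%N * u 0%N by rewrite mulr_gt0.
exists (C / (alpha * (m 0%N * u 0%N))) => K.
rewrite ler_pdivlMr ?mulr_gt0// mulrC -mulrA; apply: le_trans (bC K.+1).
rewrite (harmonic_mass _ hu) -[leLHS]add0r lerD//.
  by rewrite mulr_ge0 ?(ltW u0)// sumr_ge0// => k _; exact: ltW.
rewrite ler_pM2l// /tail_sum mulr_sumr; apply: ler_sum => r _.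
rewrite ler_wpM2r ?(H r).2//; exact: inner_tail_ge0.
Qed.

(** In [harmonic_mass] every partial sum is at most the one on the left-hand
    side. For [alpha] small the second term is therefore at most half of the
    left-hand side. *)
Lemma entrance_summable_harmonic : entrance_at_infinity m c ->
  exists alpha u, [/\ 0 < alpha, harmonic_flux alpha u, forall x, 1 <= u x &
    bounded_sums (fun x => m x * u x)].
Proof.
move=> entr; have [M bM] := entrance_bounded_mass m0 c0 entr.
case: entr => C bC.
have C0 : 0 <= C by apply: le_trans (bC 0%N); rewrite /tail_sum big_nil.
pose alpha := (2 * (C + 1))^-1.
have a0 : 0 < alpha by rewrite invr_gt0; lra.
(* The recursion computes [u x] together with the sum of [m * u] up to [x]. *)
pose st := fix st x : R * R := if x is y.+1 then
    let: (v, T) := st y in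
    let v' := v + alpha * T / c y in (v', T + m x * v')
  else (1, m 0%N).
pose u x := (st x).1.
have stE x : (st x).2 = \sum_(0 <= j < x.+1) m j * u j.
  elim: x => [|x IH]; first by rewrite big_nat1 /u/= mulr1.
  by rewrite big_nat_recr//= -IH /u/=; case: (st x).
have hu : harmonic_flux alpha u.
  move=> r; rewrite -stE /u/=; case: (st r) => v T /=.
  by rewrite addrC addKr mulrC divfK ?gt_eqF.
have H := harmonic_flux_grows a0 hu ler01.
exists alpha, u; split=> //; first by move=> x; exact: (H x).1.
exists (2 * M) => -[|K].
  by rewrite big_nil mulr_ge0// (le_trans _ (bM 0%N))// big_nil.
set SK := \sum_(0 <= k < K.+1) _.
have SKm r : (r <= K)%N -> \sum_(0 <= j < r.+1) m j * u j <= SK.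
  move=> rK; rewrite /SK (@big_cat_nat _ _ _ r.+1 0 K.+1)//= lerDl sumr_ge0// => j _.
  rewrite mulr_ge0 ?(ltW (m0 _))//; exact: le_trans ler01 (H j).1.
have SK0 : 0 <= SK.
  apply: le_trans (SKm 0%N (leq0n _)); rewrite big_nat1 mulr_ge0 ?(ltW (m0 _))//.
have : SK <= M + alpha * (SK * C).
  rewrite {1}/SK (harmonic_mass _ hu) lerD ?mul1r//.
  rewrite ler_pM2l//; apply: le_trans (ler_wpM2l SK0 (bC K)).
  rewrite /tail_sum mulr_sumr big_nat_cond [leRHS]big_nat_cond.
  apply: ler_sum => r; rewrite andbT => /andP[_ rK].
  by rewrite ler_wpM2r ?inner_tail_ge0// SKm// ltnW.
have : alpha * (SK * C) <= SK / 2.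
  rewrite mulrCA ler_wpM2l// /alpha mulrC ler_pdivrMr; last by lra.
  by lra.
by lra.
Qed.

End HarmonicFlux.

(** * Conditions stated with extended sums *)

Section ExtendedSums.
Context {R : realType}.
Local Open Scope ereal_scope.

Lemma nneseries_lty (a : nat -> R) : (forall k, 0 <= a k)%R ->
  (\sum_(0 <= k <oo) (a k)%:E < +oo) <-> bounded_sums a.
Proof.
move=> a0; have a0' k : (0 <= k)%N -> true -> 0 <= (a k)%:E by rewrite lee_fin.
split=> [fin|[C bC]].
  have Sfin : \sum_(0 <= k <oo) (a k)%:E \is a fin_num.
    by rewrite ge0_fin_numE// nneseries_ge0.
  exists (fine (\sum_(0 <= k <oo) (a k)%:E)) => n.
  by rewrite -lee_fin fineK// -sumEFin; exact: nneseries_lim_ge.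
apply: (@le_lt_trans _ _ C%:E); last exact: ltry.
apply: lime_le; first exact: is_cvg_nneseries.
by apply: nearW => n; rewrite sumEFin lee_fin.
Qed.

Lemma nneseries_pinftyP (a : nat -> R) : (forall k, 0 <= a k)%R ->
  (\sum_(0 <= k <oo) (a k)%:E = +oo) <-> ~ bounded_sums a.
Proof.
move=> a0; rewrite -nneseries_lty// ltey; split=> [->|/negP/negPn/eqP//].
by rewrite eqxx.
Qed.

Lemma ell2P (m f : nat -> R) : (forall x, 0 < m x)%R ->
  ell m 2 f <-> l2 m f.
Proof.
move=> m0; rewrite /ell; have E x : (`|f x| `^ 2 * m x = f x ^+ 2 * m x)%R.
  by rewrite powR_mulrn// real_normK// num_real.
under eq_eseriesr do rewrite E.
by rewrite nneseries_lty// => x; rewrite mulr_ge0 ?sqr_ge0// ltW.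
Qed.

Lemma ell1P (m u : nat -> R) : (forall x, 0 < m x)%R ->
  ell m 1 u <-> bounded_sums (fun x => `|u x| * m x)%R.
Proof.
move=> m0; rewrite /ell; under eq_eseriesr do rewrite powRr1//.
by rewrite nneseries_lty// => x; rewrite mulr_ge0// ltW.
Qed.

Lemma vertex_measureT_pinfty (m : nat -> R) : (forall x, 0 < m x)%R ->
  (vertex_measure m [set: nat] = +oo) <-> ~ bounded_sums m.
Proof.
move=> m0; rewrite -nneseries_pinftyP => [|k]; last exact: ltW.
rewrite /vertex_measure (_ : [set: nat] = [set x | xpredT x]).
  by rewrite -nneseries_esum// => n _; rewrite lee_fin ltW.
by apply/seteqP.
Qed.

Lemma vertex_measure_tail (m : nat -> R) r : (forall x, 0 < m x)%R ->
  bounded_sums m -> vertex_measure m [set x | (r < x)%N] = (tail_mass m r)%:E.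
Proof.
move=> m0 bm; rewrite /vertex_measure -(nneseries_esum (P := fun x => (r < x)%N)).
  rewrite -(@eseries_cond _ _ xpredT r.+1).
  apply/cvg_lim => //; rewrite -cvg_shiftS/=.
  under eq_fun do rewrite sumEFin.
  by apply: cvg_EFin; [exact: nearW|exact: inner_tail_cvg].
by move=> n _; rewrite lee_fin ltW.
Qed.

(** If the mass is finite and the series of the [m(B_r^c) / c r] diverges,
    then so does that of the [1 / c r], since the [m(B_r^c)] are bounded. *)
Lemma volume_conditionP (m c : nat -> R) :
  (forall x, 0 < m x)%R -> (forall r, 0 < c r)%R ->
  (vertex_measure m [set: nat] = +oo \/
   \sum_(0 <= r <oo) (c r)^-1%:E = +oo /\
   \sum_(0 <= r <oo) (vertex_measure m [set x | (r < x)%N] * (c r)^-1%:E) = +oo)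
  <-> ~ entrance_at_infinity m c.
Proof.
move=> m0 c0; rewrite vertex_measureT_pinfty//.
have ci0 r : (0 <= (c r)^-1)%R by rewrite invr_ge0 ltW.
rewrite nneseries_pinftyP//.
have tailE : bounded_sums m ->
    (\sum_(0 <= r <oo) (vertex_measure m [set x | (r < x)%N] * (c r)^-1%:E) = +oo)
    <-> ~ bounded_sums (fun r => tail_mass m r / c r)%R.
  move=> bm; rewrite -nneseries_pinftyP.
    by under eq_eseriesr do rewrite vertex_measure_tail// -EFinM.
  by move=> r; rewrite mulr_ge0// tail_mass_ge0.
split=> [H entr|nentr].
  have bm := entrance_bounded_mass m0 c0 entr.
  case: H => [//|[_]]; rewrite tailE//; apply; exact: entrance_tail_bounded.
have [bm|] := pselect (bounded_sums m); last by left.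
right; rewrite tailE//; split=> [[C bC]|[C bC]]; apply: nentr.
  have [M bM] := bm; exists (M * C)%R => K.
  apply: (@le_trans _ _ (M * \sum_(0 <= r < K) (c r)^-1)%R); last first.
    by rewrite ler_wpM2l// (le_trans _ (bM 0%N))// big_nil.
  rewrite /tail_sum mulr_sumr; apply: ler_sum => r _; rewrite ler_wpM2r//.
  apply: le_trans (inner_tail_le m0 bm r K) _.
  rewrite /tail_mass (le_trans _ (_ : limn (series m) <= M))%R//.
    by rewrite gerBl sumr_ge0// => k _; exact: ltW.
  by apply: limr_le; [exact: bounded_mass_cvg|exact: nearW].
exists C => K; apply: le_trans (bC K); rewrite /tail_sum; apply: ler_sum => r _.
by rewrite ler_wpM2r//; exact: inner_tail_le.
Qed.

End ExtendedSums.

(** * The Laplacian and the Neumann form of the chain *)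

Section BirthDeathOperators.
Context {R : realType} (m : nat -> R) (b : nat -> nat -> R).
Hypothesis hb : birth_death_chain m b.
Implicit Types (f g h u F : nat -> R).

Definition edge_weight (r : nat) : R := b r r.+1.
Local Notation c := edge_weight.

Let m0 x : 0 < m x. Proof. exact: vertex_measure_gt0 hb x. Qed.

Lemma edge_weight_gt0 r : 0 < c r.
Proof. by apply/(weight_gt0 hb); lia. Qed.

Let c0 := edge_weight_gt0.

Lemma weight_eq0 (x y : nat) : `|x - y|%N <> 1%N -> b x y = 0.
Proof.
move=> xy; apply/eqP; rewrite eq_le (weight_ge0 hb) andbT leNgt.
by apply/negP => /(weight_gt0 hb).
Qed.

Definition neighbour_sum F x : R := F x.+1 + if x is z.+1 then F z else 0.

Lemma sum_neighbours (x : nat) F : (forall y : nat, `|x - y|%N <> 1%N -> F y = 0) ->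
  forall n, (x.+2 <= n)%N -> \sum_(0 <= y < n) F y = neighbour_sum F x.
Proof.
move=> F0 n xn; rewrite -(subnKC xn) sum_nat_addn [X in _ + X]big1 ?addr0; last first.
  by move=> k _; apply: F0; lia.
rewrite big_nat_recr//= big_nat_recr//= (F0 x) ?addr0; last by lia.
rewrite /neighbour_sum addrC; congr (_ + _).
case: x F0 {xn} => [|x] F0; first by rewrite big_nil.
rewrite big_nat_recr//= big_nat_cond big1 ?add0r// => k; rewrite andbT => /andP[_ kx].
by apply: F0; lia.
Qed.

Lemma limn_eventually (u : nat -> R) N l :
  (forall n, (N <= n)%N -> u n = l) -> limn u = l.
Proof. by move=> ul; apply: lim_near_cst => //; exists N. Qed.

Lemma lim_series_neighbours (x : nat) F : (forall y : nat, `|x - y|%N <> 1%N -> F y = 0) ->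
  limn (series F) = neighbour_sum F x.
Proof. by move=> F0; apply: (@limn_eventually _ x.+2); exact: sum_neighbours. Qed.

Lemma eseries_neighbours (x : nat) F : (forall y : nat, `|x - y|%N <> 1%N -> F y = 0) ->
  (\sum_(0 <= y <oo) (F y)%:E)%E = (neighbour_sum F x)%:E.
Proof.
move=> F0; apply: lim_near_cst => //; exists x.+2 => // n /= xn.
by rewrite sumEFin (sum_neighbours F0).
Qed.

Lemma alpha_harmonicP alpha u : alpha_harmonic m b alpha u <-> harmonic_flux m c alpha u.
Proof.
have lapE x : laplacian m b u x + alpha * u x = 0 <->
    c x * (u x.+1 - u x) = (if x is z.+1 then c z * (u x - u z) else 0) +
    alpha * (m x * u x).
  rewrite /laplacian (@lim_series_neighbours x); last first.
    by move=> y xy /=; rewrite weight_eq0// mul0r.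
  rewrite /neighbour_sum/=.
  have -> : (m x)^-1 * (b x x.+1 * (u x - u x.+1) +
      (if x is z.+1 then b x z * (u x - u z) else 0)) + alpha * u x =
      (m x)^-1 * (- (c x * (u x.+1 - u x)) +
      ((if x is z.+1 then c z * (u x - u z) else 0) + alpha * (m x * u x))).
    rewrite /c; case: x => [|x]; last rewrite (weight_sym hb x.+1 x); field;
    by rewrite gt_eqF.
  split=> [/eqP|->]; last by rewrite addNr mulr0.
  by rewrite mulf_eq0 invr_eq0 gt_eqF//= addrC subr_eq0 => /eqP.
split=> [hu r|hu x].
  elim: r => [|r IH].
    by have /lapE := hu 0%N; rewrite add0r big_nat1.
  by have /lapE -> := hu r.+1; rewrite IH -mulrDr -big_nat_recr.
apply/lapE; rewrite hu; case: x => [|x]; first by rewrite big_nat1 add0r.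
by rewrite big_nat_recr//= mulrDr hu.
Qed.

Definition edge_product f g x : R := c x * (f x - f x.+1) * (g x - g x.+1).

Lemma neighbour_edge_product f g x :
  neighbour_sum (fun y => b x y * (f x - f y) * (g x - g y)) x =
  edge_product f g x + if x is z.+1 then edge_product f g z else 0.
Proof.
rewrite /neighbour_sum /edge_product /c; congr (_ + _).
by case: x => // x; rewrite (weight_sym hb x.+1 x); ring.
Qed.

(** In the energy each edge is seen from both of its ends, which accounts
    for the factor 1/2 of the form. *)
Lemma sum_shifted_pair (e : nat -> R) n :
  \sum_(0 <= x < n.+1) (e x + if x is z.+1 then e z else 0) =
  \sum_(0 <= x < n.+1) e x + \sum_(0 <= x < n) e x.
Proof.
rewrite big_split/=; congr (_ + _).
by rewrite big_nat_recl//= add0r.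
Qed.

Lemma energy_form_edges f g N l :
  (forall n, (N <= n)%N -> \sum_(0 <= x < n) edge_product f g x = l) ->
  energy_form b f g = l.
Proof.
move=> sl; rewrite /energy_form.
have -> : (fun x => limn [series b x y * (f x - f y) * (g x - g y)]_y) =
    (fun x => edge_product f g x + if x is z.+1 then edge_product f g z else 0).
  apply/funext => x; rewrite -neighbour_edge_product; apply: lim_series_neighbours.
  by move=> y xy /=; rewrite weight_eq0// !mul0r.
rewrite (@limn_eventually _ N.+1 (l + l)); first by field.
move=> [//|n] Nn; rewrite /series/= sum_shifted_pair !sl//; exact: leqW.
Qed.

Lemma neumann_domP h : l2 m h -> bounded_sums (edge_product h h) ->
  neumann_dom m b h.
Proof.
move=> lh [C bC]; split; first exact/(ell2P _ m0).
have e0 x : 0 <= edge_product h h x.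
  by rewrite /edge_product -mulrA mulr_ge0 ?(ltW (c0 _))// -expr2 sqr_ge0.
rewrite /energy; under eq_eseriesr => x _.
  rewrite (@eseries_neighbours x); last by move=> y xy; rewrite weight_eq0// mul0r.
  have -> : (fun y => b x y * (h x - h y) ^+ 2) =
            (fun y => b x y * (h x - h y) * (h x - h y)).
    by apply/funext => y; rewrite expr2 mulrA.
  rewrite neighbour_edge_product; over.
rewrite lte_mul_pinfty// nneseries_lty.
  exists (C + C) => -[|n]; last by rewrite sum_shifted_pair lerD.
  by rewrite big_nil addr_ge0// (le_trans _ (bC 0%N))// big_nil.
by move=> x; rewrite addr_ge0//; case: x.
Qed.

Lemma edge_product_ball f N x :
  edge_product f (ball_ind N) x = if x == N then c N * (f N - f N.+1) else 0.
Proof.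
rewrite /edge_product /ball_ind; case: (ltngtP x N) => [xN|xN|->].
- by rewrite subrr mulr0.
- by rewrite subrr mulr0.
- by rewrite subr0 mulr1.
Qed.

Lemma sum_edge_product_ball f N n : (N < n)%N ->
  \sum_(0 <= x < n) edge_product f (ball_ind N) x = c N * (f N - f N.+1).
Proof.
move=> Nn; under eq_bigr do rewrite edge_product_ball.
by rewrite -big_mkcond/= big_nat1_eq Nn.
Qed.

Lemma l2_ball N : l2 m (ball_ind N).
Proof.
exists (\sum_(0 <= x < N.+1) m x) => n.
apply: (@le_trans _ _ (\sum_(0 <= x < n + N.+1) ball_ind N x ^+ 2 * m x)).
  rewrite sum_nat_addn lerDl sumr_ge0// => k _.
  by rewrite mulr_ge0 ?sqr_ge0// ltW.
rewrite addnC sum_nat_addn [X in _ + X]big1 ?addr0; last first.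
  by move=> k _; rewrite /ball_ind addSnnS leqNgt addnS ltnS leq_addr expr0n mul0r.
apply: ler_sum => k _; rewrite ler_piMl ?(ltW (m0 _))// /ball_ind.
by case: (k <= N)%N; rewrite ?expr1n// expr0n.
Qed.

Lemma neumann_dom_ball N : neumann_dom m b (ball_ind N).
Proof.
apply: neumann_domP; first exact: l2_ball.
exists (c N) => n; under eq_bigr do rewrite edge_product_ball.
rewrite -big_mkcond/= big_nat1_eq; case: ifP => _; last exact: ltW.
by rewrite /ball_ind leqnn ltnn subr0 mulr1.
Qed.

Lemma neumann_dom1 : bounded_sums m -> neumann_dom m b (fun=> 1).
Proof.
move=> bm; apply: neumann_domP.
  by apply: bounded_sums_le bm => k; rewrite expr1n mul1r.
by exists 0 => n; rewrite big1// => k _; rewrite /edge_product subrr mulr0.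
Qed.

(** The form is tested with the indicators of the balls and, for a finite
    mass, with the constant 1, whose energy is 0. *)
Lemma neumann_resolves (eps : R) f g : 0 < eps -> l2 m f -> l2 m g ->
  neumann_laplacian m b g (fun x => eps^-1 * (f x - g x)) -> resolves m c eps f g.
Proof.
move=> eps0 lf lg [_ /(ell2P _ m0) lk test]; split=> // [r|bm].
  have := test _ (neumann_dom_ball r).
  rewrite (energy_form_edges (N := r.+1) (l := c r * (g r - g r.+1))); last first.
    exact: sum_edge_product_ball.
  rewrite /inner_prod (@limn_eventually _ r.+1
    (eps^-1 * \sum_(0 <= j < r.+1) m j * (f j - g j))); last first.
    move=> n rn; rewrite /series/= -(subnKC rn) sum_nat_addn [X in _ + X]big1 ?addr0; last first.
      by move=> k _; rewrite /ball_ind addSnnS leqNgt addnS ltnS leq_addr mulr0 mul0r.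
    rewrite mulr_sumr big_nat_cond [RHS]big_nat_cond; apply: eq_bigr => j.
    by rewrite andbT ltnS => /andP[_ jr]; rewrite /ball_ind jr mulr1; ring.
  move=> E; rewrite -opprB mulrN E -mulrN -sumrN; congr (_ * _).
  by apply: eq_bigr => j _; ring.
have := test _ (neumann_dom1 bm).
rewrite (energy_form_edges (N := 0) (l := 0)); last first.
  by move=> n _; rewrite big1// => x _; rewrite /edge_product subrr mulr0.
rewrite /inner_prod; set s := series _ => lims.
have cvgs : cvgn s.
  apply: normed_cvg; apply: bounded_sums_cvg => [k|]; first exact: normr_ge0.
  apply: (bounded_sums_le (a' := fun x => (eps^-1 * (f x - g x)) ^+ 2 * m x + m x)) => [x|] /=.
    rewrite mulr1 normrM (ger0_norm (ltW (m0 x))) -{3}[m x]mul1r -mulrDl ler_pM2r//.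
    set k := eps^-1 * _; have := sqr_ge0 (`|k| - 1).
    have := normr_ge0 k; rewrite -(real_normK (num_real k)); nra.
  exact: bounded_sumsD.
have H : - eps * s n @[n --> \oo] --> - eps * 0.
  by apply: cvgM; [exact: cvg_cst|rewrite lims; exact: cvgs].
rewrite mulr0 in H; apply: cvg_trans H; apply: near_eq_cvg; apply: nearW => n.
rewrite /s /series/= mulr_sumr; apply: eq_bigr => j _.
by field; rewrite gt_eqF.
Qed.

End BirthDeathOperators.

(** * A uniform form of the Euler limit *)

Section ExponentialFormula.
Context {R : realType}.

Lemma binomial_lower_bound (y : R) n : 0 <= y ->
  1 + n%:R * y + n%:R * (n%:R - 1) / 2 * y ^+ 2 <= (1 + y) ^+ n.
Proof.
move=> y0; elim: n => [|n IH]; first by rewrite expr0; lra.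
have y1 : 0 <= 1 + y by lra.
rewrite [leRHS]exprS; apply: (le_trans _ (ler_wpM2l y1 IH)).
have n1 : 0 <= n%:R * (n%:R - 1) :> R.
  case: n {IH} => [|n]; first by rewrite mul0r.
  by rewrite mulr_ge0// subr_ge0 ler1n.
rewrite -natr1 -subr_ge0.
rewrite [leRHS](_ : _ = n%:R * (n%:R - 1) / 2 * y ^+ 3); last by field.
by rewrite mulr_ge0 ?exprn_ge0// divr_ge0.
Qed.

Lemma exprn_sub_le (p q : R) n : 0 <= q -> q <= p ->
  p ^+ n.+1 - q ^+ n.+1 <= n.+1%:R * (p - q) * p ^+ n.
Proof.
move=> q0 qp; have p0 := le_trans q0 qp.
elim: n => [|n IH]; first by rewrite expr0 !expr1; lra.
have -> : p ^+ n.+2 - q ^+ n.+2 = p * (p ^+ n.+1 - q ^+ n.+1) + (p - q) * q ^+ n.+1.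
  by rewrite !(exprS _ n.+1); ring.
have : p * (p ^+ n.+1 - q ^+ n.+1) <= p * (n.+1%:R * (p - q) * p ^+ n).
  exact: ler_wpM2l.
have : (p - q) * q ^+ n.+1 <= (p - q) * p ^+ n.+1.
  by rewrite ler_wpM2l ?subr_ge0// lerXn2r.
rewrite -(natr1 n.+1) (exprS p n); lra.
Qed.

(** With [p = (1 + y)^-1] and [q = e^(-y)] one has [0 <= p - q <= y ^ 2 *
    p]. So the difference of the [n]-th powers is at most [n * y ^ 2 * p ^
    n], and the quadratic term of the binomial expansion of [(1 + y) ^ n]
    makes this bounded in [y] and of order [1 / n]. *)
Lemma euler_expR_bound (y : R) k : 0 <= y ->
  `|expR (- (k.+2%:R * y)) - (1 + y) ^- k.+2| <= 2 / k.+1%:R.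
Proof.
move=> y0; have y1 : 0 < 1 + y by lra.
set p := (1 + y)^-1; set q := expR (- y).
have qp : q <= p by rewrite /q expRN lef_pV2 ?posrE ?expR_gt0// expR_ge1Dx.
have q0 : 0 <= q by exact: expR_ge0.
have p0 : 0 < p by rewrite invr_gt0.
have pq : p - q <= y ^+ 2 * p.
  have : 1 - y <= q by exact: expR_ge1Dx.
  have : p * (1 + y) = 1 by rewrite mulVf ?gt_eqF.
  nra.
rewrite -mulrN expRM_natl -exprVn -/p -/q distrC ger0_norm; last first.
  by rewrite subr_ge0 lerXn2r// nnegrE// ltW.
apply: le_trans (exprn_sub_le k.+1 q0 qp) _.
apply: (@le_trans _ _ (k.+2%:R * (y ^+ 2 * p) * p ^+ k.+1)).
  by rewrite ler_wpM2r ?exprn_ge0 ?(ltW p0)// ler_pM2l.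
have -> : k.+2%:R * (y ^+ 2 * p) * p ^+ k.+1 = k.+2%:R * y ^+ 2 / (1 + y) ^+ k.+2.
  by rewrite -exprVn -/p (exprS p k.+1); ring.
rewrite ler_pdivrMr ?exprn_gt0// mulrAC ler_pdivlMr//.
have := binomial_lower_bound k.+2 y0.
have -> : k.+2%:R - 1 = k.+1%:R :> R by rewrite -(natr1 k.+1) addrK.
have : 0 <= k.+2%:R * y by rewrite mulr_ge0.
by lra.
Qed.

End ExponentialFormula.

(** * Resolvents and semigroup in a spectral representation *)

Section SpectralResolvents.
Context {R : realType} (m : nat -> R) (A : (nat -> R) -> (nat -> R) -> Prop).
Context d (T : measurableType d) (mu : {measure set T -> \bar R}).
Context (phi : T -> R) (U : (nat -> R) -> T -> R).
Hypotheses (m0 : forall x, 0 < m x) (sr : spectral_representation m A mu phi U).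
Implicit Types (f g h : nat -> R).

Let uU := spectral_unitary sr.
Let phi0 t : 0 <= phi t := spectral_ge0 sr t.

Lemma Lfun2_le (F H : T -> R) : measurable_fun setT F -> H \in Lfun mu 2%:E ->
  (forall t, `|F t| <= `|H t|) -> F \in Lfun mu 2%:E.
Proof.
move=> mF /[!inE]/= /andP[/[!inE]/= mH]; rewrite /finite_norm => finH FH.
apply/andP; split; rewrite inE//=.
apply: le_lt_trans finH; rewrite unlock gt0_ler_poweR ?invr_ge0//.
- by rewrite in_itv/= leey integral_ge0// => t _; exact: poweR_ge0.
- by rewrite in_itv/= leey integral_ge0// => t _; exact: poweR_ge0.
apply: ge0_le_integral => //.
- by move=> t _; exact: poweR_ge0.
- apply/measurable_EFinP; apply: (measurableT_comp (measurable_powR _)) => //.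
  exact: measurableT_comp.
- apply/measurable_EFinP; apply: (measurableT_comp (measurable_powR _)) => //.
  exact: measurableT_comp.
- move=> t _ /=; rewrite lee_fin; apply: ge0_ler_powR => //; rewrite ?nnegrE//.
Qed.

Lemma measurable_U f : ell m 2 f -> measurable_fun setT (U f).
Proof. by move=> /(unitary_L2 uU); rewrite inE/= => /andP[/[!inE]]. Qed.

(** The resolvent is multiplication by [(1 + eps * phi)^-1], a bounded
    function; surjectivity of [U] brings the product back to l^2. *)
Lemma spectral_resolvent (eps : R) f : 0 < eps -> ell m 2 f ->
  exists g, [/\ ell m 2 g, A g (fun x => eps^-1 * (f x - g x)) &
    {ae mu, forall t, U g t = (1 + eps * phi t)^-1 * U f t}].
Proof.
move=> eps0 lf.
have d0 t : 0 < 1 + eps * phi t by rewrite ltr_wpDr// mulr_ge0// ltW.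
pose F t := (1 + eps * phi t)^-1 * U f t.
have mphi := spectral_measurable sr.
have LF : F \in Lfun mu 2%:E.
  apply: Lfun2_le (unitary_L2 uU lf) _.
    apply: measurable_funM; last exact: measurable_U.
    (* Inversion is measurable as a real power. *)
    under eq_fun => t do rewrite -powR_inv1 ?(ltW (d0 t))//.
    apply: (measurableT_comp (measurable_powR _)).
    by apply: measurable_funD => //; exact: measurable_funM.
  move=> t; rewrite /F normrM ler_piMl// ger0_norm ?invr_ge0 ?(ltW (d0 t))//.
  by rewrite invf_le1// lerDl mulr_ge0// ltW.
have [g lg gF] := unitary_onto uU LF.
exists g; split=> //.
set h := fun x => eps^-1 * (f x - g x).
have lh : ell m 2 h.
  apply/(ell2P _ m0); have : l2 m (fun x => - eps^-1 * g x + 0).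
    apply: l2_lin => //; first exact/(ell2P _ m0).
    by exists 0 => n; rewrite big1// => j _; rewrite expr0n mul0r.
  move=> /(l2_lin eps^-1 m0 (iffLR (ell2P f m0) lf)).
  by congr (l2 m _); apply/funext => x; rewrite /h; ring.
apply/(spectral_graph sr lg lh).
have := unitary_linear uU eps lh lg.
have -> : (fun x => eps * h x + g x) = f.
  by apply/funext => x; rewrite /h mulrA divff ?gt_eqF// mul1r subrK.
move=> Ulin; near=> t.
have Uf : U f t = eps * U h t + U g t by near: t.
have Ug : U g t = F t by near: t.
have Uf' : (1 + eps * phi t) * U g t = U f t.
  by rewrite Ug /F mulrA divff ?mul1r// gt_eqF.
by apply: (mulfI (lt0r_neq0 eps0)); lra.
Unshelve. all: by end_near. Qed.

Lemma spectral_iterates (eps : R) f : 0 < eps -> ell m 2 f ->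
  exists G : nat -> nat -> R, [/\ G 0%N = f, forall k, ell m 2 (G k),
    forall k, A (G k.+1) (fun x => eps^-1 * (G k x - G k.+1 x)) &
    forall k, {ae mu, forall t, U (G k) t = (1 + eps * phi t) ^- k * U f t}].
Proof.
move=> eps0 lf.
have /choice[J JP] : forall h, exists g, ell m 2 h ->
    [/\ ell m 2 g, A g (fun x => eps^-1 * (h x - g x)) &
    {ae mu, forall t, U g t = (1 + eps * phi t)^-1 * U h t}].
  move=> h; have [lh|nlh] := pselect (ell m 2 h); last by exists h.
  by have [g gP] := spectral_resolvent eps0 lh; exists g.
have lG k : ell m 2 (iter k J f) by elim: k => // k IH; have [] := JP _ IH.
exists (fun k => iter k J f); split=> // [k|].
  by have [] := JP _ (lG k).
elim=> [|k IH]; first by apply: aeW => t; rewrite expr0 invr1 mul1r.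
have [_ _ Jk] := JP _ (lG k).
near=> t.
have -> : U (iter k.+1 J f) t = (1 + eps * phi t)^-1 * U (iter k J f) t by near: t.
have -> : U (iter k J f) t = (1 + eps * phi t) ^- k * U f t by near: t.
by rewrite exprS invfM mulrA.
Unshelve. all: by end_near. Qed.

(** The L^2 bound becomes a pointwise one because each vertex has positive
    mass. Here [C] is the squared norm of [f]. *)
Lemma spectral_bound_pointwise f : ell m 2 f ->
  exists2 C : R, 0 <= C & forall (K : R) g h, 0 <= K -> ell m 2 g -> ell m 2 h ->
    {ae mu, forall t, `|U g t - U h t| <= K * `|U f t|} ->
    forall x, (g x - h x) ^+ 2 * m x <= K ^+ 2 * C.
Proof.
move=> lf; have term0 q x : 0 <= q x ^+ 2 * m x by rewrite mulr_ge0 ?sqr_ge0// ltW.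
have [C C0 fC] : exists2 C : R, 0 <= C &
    (\sum_(0 <= x <oo) (f x ^+ 2 * m x)%:E = C%:E)%E.
  have /(nneseries_lty (term0 f)) fin := iffLR (ell2P f m0) lf.
  have S0 : (0 <= \sum_(0 <= x <oo) (f x ^+ 2 * m x)%:E)%E.
    by apply: nneseries_ge0 => x _ _; rewrite lee_fin.
  exists (fine (\sum_(0 <= x <oo) (f x ^+ 2 * m x)%:E)%E); first exact: fine_ge0.
  by rewrite fineK// ge0_fin_numE.
(* The coordinate of [g - h] at [x] is bounded by its norm, which [U]
   preserves. *)
exists C => // K g h K0 lg lh gh x.
set D := fun x => g x - h x.
have lD : ell m 2 D.
  apply/(ell2P _ m0).
  have := l2_lin (-1) m0 (iffLR (ell2P h m0) lh) (iffLR (ell2P g m0) lg).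
  by congr (l2 m _); apply/funext => y; rewrite /D; ring.
have UD : {ae mu, forall t, U g t = 1 * U D t + U h t}.
  have := unitary_linear uU 1 lD lh.
  have -> // : (fun x => 1 * D x + h x) = g.
  by apply/funext => y; rewrite /D mul1r subrK.
rewrite -lee_fin (_ : (_ * m x)%:E = (D x ^+ 2 * m x)%:E)//.
apply: (@le_trans _ _ (\sum_(0 <= x <oo) (D x ^+ 2 * m x)%:E)%E).
  apply: le_trans (nneseries_lim_ge x.+1 _); last by move=> y _ _; rewrite lee_fin.
  rewrite big_nat_recr//= leeDr// sume_ge0// => y _.
  by rewrite lee_fin.
rewrite -(unitary_isometry uU lD) EFinM -fC -(unitary_isometry uU lf).
rewrite -ge0_integralZl_EFin ?sqr_ge0//; last first.
- apply/measurable_EFinP/measurable_funX; exact: measurable_U.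
- by move=> t _; rewrite lee_fin sqr_ge0.
apply: ae_ge0_le_integral => //.
- by move=> t _; rewrite lee_fin sqr_ge0.
- apply/measurable_EFinP/measurable_funX; exact: measurable_U.
- by move=> t _; rewrite mule_ge0// lee_fin sqr_ge0.
- apply: measurable_funeM; apply/measurable_EFinP/measurable_funX; exact: measurable_U.
near=> t => _.
have Et : U g t = 1 * U D t + U h t by near: t.
have : `|U g t - U h t| <= K * `|U f t| by near: t.
rewrite Et mul1r addrK -EFinM lee_fin => le_t.
rewrite -[leLHS]real_normK ?num_real// -[U f t ^+ 2]real_normK ?num_real//.
by rewrite -exprMn lerXn2r// nnegrE mulr_ge0.
Unshelve. all: by end_near. Qed.

Lemma spectral_exponential_formula (t : R) f Pf (G : nat -> nat -> nat -> R) :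
  0 < t -> ell m 2 f -> ell m 2 Pf ->
  {ae mu, forall s, U Pf s = expR (- (t * phi s)) * U f s} ->
  (forall k, ell m 2 (G k k.+2)) ->
  (forall k, {ae mu, forall s,
     U (G k k.+2) s = (1 + t / k.+2%:R * phi s) ^- k.+2 * U f s}) ->
  forall x, G k k.+2 x @[k --> \oo] --> Pf x.
Proof.
move=> t0 lf lPf UPf lG UG x.
have [C C0 bC] := spectral_bound_pointwise lf.
have bound k : `|Pf x - G k k.+2 x| <= 2 * Num.sqrt (C / m x) * k.+1%:R^-1.
  have K0 : 0 <= 2 / k.+1%:R :> R by [].
  have := bC _ _ _ K0 lPf (lG k) _ x; rewrite -ler_pdivlMr// => H.
  have {}H : (Pf x - G k k.+2 x) ^+ 2 <= (2 / k.+1%:R) ^+ 2 * C / m x.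
    apply: H; near=> s.
    have -> : U Pf s = expR (- (t * phi s)) * U f s by near: s.
    have -> : U (G k k.+2) s = (1 + t / k.+2%:R * phi s) ^- k.+2 * U f s by near: s.
    rewrite -mulrBl normrM ler_wpM2r//.
    have y0 : 0 <= t / k.+2%:R * phi s by rewrite mulr_ge0// divr_ge0// ltW.
    have := euler_expR_bound k y0.
    by rewrite mulrA [k.+2%:R * _]mulrC divfK ?pnatr_eq0.
  rewrite -(ler_pXn2r (n := 2))// ?nnegrE ?mulr_ge0 ?sqrtr_ge0 ?invr_ge0//.
  rewrite real_normK ?num_real// (le_trans H)//.
  rewrite !exprMn sqr_sqrtr ?divr_ge0 ?(ltW (m0 _))//.
  by rewrite le_eqVlt; apply/orP; left; apply/eqP; ring.
apply/cvgrPdist_le => e e0.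
have cvg0 : 2 * Num.sqrt (C / m x) * k.+1%:R^-1 @[k --> \oo] -->
    2 * Num.sqrt (C / m x) * 0.
  by apply: cvgM; [exact: cvg_cst|exact: cvg_harmonic].
rewrite mulr0 in cvg0; move/cvgrPdist_le: cvg0 => /(_ e e0).
apply: filterS => k; rewrite sub0r normrN => /(le_trans (ler_norm _)).
exact: le_trans (bound k).
Unshelve. all: by end_near. Qed.

End SpectralResolvents.

(** * The Feller property and the equivalence *)

Section FellerCriterion.
Context {R : realType} (m : nat -> R) (b : nat -> nat -> R).
Context (P : R -> (nat -> R) -> nat -> R).
Hypotheses (hb : birth_death_chain m b) (hP : is_neumann_semigroup m b P).
Implicit Types (f g : nat -> R).

Local Notation c := (edge_weight b).

Let m0 x : 0 < m x. Proof. exact: vertex_measure_gt0 hb x. Qed.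
Let c0 r : 0 < c r. Proof. exact: edge_weight_gt0 hb r. Qed.

Lemma semigroup_as_resolvent_limit (t : R) f : 0 < t -> l2 m f ->
  exists H : nat -> nat -> nat -> R,
    (forall k, resolvent_iterates m c (t / k.+2%:R) f (H k)) /\
    (forall x, H k k.+2 x @[k --> \oo] --> P t f x).
Proof.
move=> t0 lf; have elf := iffRL (ell2P f m0) lf.
case: hP => d [T [mu [phi [U [sr HP]]]]].
have [lPf UPf] := HP t f (ltW t0) elf.
have eps0 k : 0 < t / k.+2%:R by rewrite divr_gt0.
have /choice[H HH] k := spectral_iterates m0 sr (eps0 k) elf.
exists H; split=> [k|].
  have [H0 lH AH _] := HH k; split=> // j.
  by apply: (neumann_resolves hb (eps0 k)) => //; exact/(ell2P _ m0).
apply: (spectral_exponential_formula m0 sr t0 elf lPf UPf) => k.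
  by have [_ + _ _] := HH k; apply.
by have [_ _ _ +] := HH k; apply.
Qed.

Lemma Cc_le_ball f : Cc f -> exists N (C : R), 0 <= C /\ forall x, `|f x| <= C * ball_ind N x.
Proof.
move=> /finite_seqP[s fs]; pose N := \max_(i <- s) i.
exists N, (\sum_(0 <= x < N.+1) `|f x|); split; first by apply: sumr_ge0.
move=> x; have [xN|Nx] := leqP x N.
  rewrite /ball_ind xN mulr1 (@big_cat_nat _ _ _ x 0 N.+1)//= 1?ltnW//.
  by rewrite [X in _ + X]big_ltn// addrCA lerDl addr_ge0// sumr_ge0.
rewrite /ball_ind leqNgt Nx mulr0 normr_le0; apply: contraTT Nx => fx0.
have : [set x | f x != 0] x by [].
by rewrite fs /= -leqNgt => xs; exact: leq_bigmax_seq.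
Qed.

Lemma ball_ind_Cc N : Cc (ball_ind N : nat -> R).
Proof.
apply: (sub_finite_set _ (finite_II N.+1)) => x /=.
by rewrite /ball_ind ltnS; case: leqP; rewrite ?eqxx.
Qed.

(** Truncation is the required approximation. *)
Lemma vanishing_C0 f :
  (forall e : R, 0 < e -> exists K, forall x, (K <= x)%N -> `|f x| <= e) -> C0 f.
Proof.
move=> f0 e e0; have [K fK] := f0 e e0.
exists (fun x => if (x < K)%N then f x else 0).
  apply: (sub_finite_set _ (finite_II K)) => x /=.
  by case: ifP => //; rewrite eqxx.
by move=> x; case: ltnP => xK; rewrite ?subrr ?normr0 ?(ltW e0)// subr0 fK.
Qed.

(** By positivity it suffices to bound the semigroup on the indicator of a
    ball, where [iterates_decay] passes to the limit. *)
Lemma feller_of_not_entrance : ~ entrance_at_infinity m c -> feller P.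
Proof.
move=> nentr; exists 1 => // f /Cc_le_ball[N [C [C0 fC]]].
have lball : l2 m (ball_ind N) by exact: (l2_ball hb).
have lf : l2 m f.
  apply: (bounded_sums_le (a' := fun x => C ^+ 2 * (ball_ind N x ^+ 2 * m x))).
    move=> x; rewrite mulrA ler_pM2r// -exprMn -[leLHS]real_normK ?num_real//.
    by rewrite lerXn2r// nnegrE mulr_ge0 ?ball_ind_ge0.
  by apply: bounded_sumsZ => //; exact: sqr_ge0.
have [H [iH cvgH]] := semigroup_as_resolvent_limit ltr01 lf.
have [B [iB _]] := semigroup_as_resolvent_limit ltr01 lball.
have eps0 k : 0 < 1 / k.+2%:R :> R by rewrite divr_gt0.
have scaled (s : R) k : resolvent_iterates m c (1 / k.+2%:R)
    (fun x => s * ball_ind N x) (fun j x => s * B k j x).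
  by have [B0 BS] := iB k; split=> [|j]; [rewrite B0|exact: resolvesZ].
have HB k x : `|H k k.+2 x| <= C * B k k.+2 x.
  rewrite ler_norml; apply/andP; split.
    rewrite -mulNr; apply: (iterates_le m0 c0 (eps0 k) (scaled _ k) (iH k)) => y.
    by rewrite mulNr; have := fC y; rewrite ler_norml => /andP[].
  apply: (iterates_le m0 c0 (eps0 k) (iH k) (scaled _ k)) => y.
  exact: le_trans (ler_norm _) (fC y).
have tail0 K : 0 <= tail_sum m c N K.
  by apply: sumr_ge0 => r _; exact: inner_tail_ge0.
have decay x : (N <= x)%N -> `|P 1 f x| * tail_sum m c N x <= C.
  move=> Nx.
  have cv : `|H k k.+2 x| * tail_sum m c N x @[k --> \oo] -->
      `|P 1 f x| * tail_sum m c N x.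
    by apply: cvgM; [apply: cvg_norm; exact: cvgH|exact: cvg_cst].
  apply: (cvgr_to_le cv); apply: nearW => k.
  apply: le_trans (ler_wpM2r (tail0 _) (HB k x)) _.
  rewrite -mulrA -[leRHS]mulr1 ler_wpM2l//.
  have := iterates_decay m0 c0 k.+2 (eps0 k) (iB k) Nx.
  by rewrite [leRHS]mulrC divfK.
apply: vanishing_C0 => e e0.
have [K HK] : exists K, C / e < tail_sum m c N K.
  apply: contrapT => noK; apply: nentr; apply: (tail_sum_bounded_entrance m0 c0 (N := N)).
  by exists (C / e) => K; rewrite leNgt; apply/negP => HK; apply: noK; exists K.
have tail_mono x : (K <= x)%N -> tail_sum m c N K <= tail_sum m c N x.
  move=> Kx; have [NK|KN] := leqP N K; last by rewrite {1}/tail_sum big_geq// ltnW.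
  rewrite /tail_sum (@big_cat_nat _ _ _ K N x)//= -[leLHS]addr0 lerD//; last first.
    by apply: sumr_ge0 => r _; exact: inner_tail_ge0.
  apply: ler_sum => r _; rewrite ler_wpM2r ?invr_ge0 ?(ltW (c0 _))//.
  have [rK|Kr] := leqP r K; last first.
    by rewrite big_geq ?sumr_ge0// => [k _|]; [exact: ltW|exact: ltnW].
  rewrite (@big_cat_nat _ _ _ K.+1 r.+1 x.+1)//= lerDl.
  by apply: sumr_ge0 => k _; exact: ltW.
exists (maxn N K) => x; rewrite geq_max => /andP[Nx Kx].
have tx := lt_le_trans HK (tail_mono x Kx).
have t0 : 0 < tail_sum m c N x.
  by apply: le_lt_trans tx; rewrite divr_ge0// ltW.
rewrite -(ler_pM2r t0); apply: le_trans (decay x Nx) _.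
by rewrite mulrC -ler_pdivrMr// ltW.
Qed.

Lemma not_entrance_of_feller : feller P -> ~ entrance_at_infinity m c.
Proof.
move=> [t t0 fel] entr.
have [N [d [d0 low]]] := entrance_iterates_lower_bound m0 c0 entr t0.
have [H [iH cvgH]] := semigroup_as_resolvent_limit t0 (l2_ball hb N).
have Pd x : d <= P t (ball_ind N) x.
  apply: (cvgr_to_ge (cvgH x)); apply: nearW => k.
  exact: low (iH k) x.
have [|g Cg gP] := fel _ (ball_ind_Cc N) (d / 2); first by rewrite divr_gt0.
apply: infinite_nat; apply: sub_finite_set Cg => x _ /=.
apply/eqP => gx0; have := gP x; rewrite gx0 subr0 => /(le_trans (ler_norm _)).
have := Pd x; lra.
Qed.

Lemma summable_harmonic_trivial : ~ entrance_at_infinity m c ->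
  forall alpha, 0 < alpha -> forall u, alpha_harmonic m b alpha u -> ell m 1 u ->
  forall x, u x = 0.
Proof.
move=> nentr alpha a0 u /(alpha_harmonicP hb) hu /(ell1P _ m0) lu.
have bu (s : R) : `|s| = 1 -> bounded_sums (fun x => m x * (s * u x)).
  move=> s1; apply: bounded_sums_le lu => k.
  by rewrite mulrC ler_pM2r// (le_trans (ler_norm _))// normrM s1 mul1r.
apply: (harmonic_flux_eq0 m0 c0 a0 hu); apply: contrapT => /eqP.
rewrite neq_lt => /orP[u0|u0]; apply: nentr.
  apply: (summable_harmonic_entrance m0 c0 a0 (harmonic_fluxN hu)).
    by rewrite oppr_gt0.
  have := bu (-1); rewrite normrN1 => /(_ erefl).
  by under eq_fun do rewrite mulN1r.
apply: (summable_harmonic_entrance m0 c0 a0 hu) => //.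
have := bu 1; rewrite normr1 => /(_ erefl).
by under eq_fun do rewrite mul1r.
Qed.

Lemma positive_summable_harmonic : entrance_at_infinity m c ->
  exists alpha u, [/\ 0 < alpha, forall x, 0 < u x, alpha_harmonic m b alpha u &
    ell m 1 u].
Proof.
move=> /(entrance_summable_harmonic m0 c0)[alpha [u [a0 hu u1 bu]]].
have u0 x : 0 < u x by exact: lt_le_trans ltr01 (u1 x).
exists alpha, u; split=> //; first exact/(alpha_harmonicP hb).
apply/(ell1P _ m0); apply: bounded_sums_le bu => k.
by rewrite mulrC ger0_norm ?(ltW (u0 _)).
Qed.

End FellerCriterion.

Theorem theorem8p2 (R : realType) (m : nat -> R) (b : nat -> nat -> R)
    (P : R -> (nat -> R) -> nat -> R)
    (hb : birth_death_chain m b) (hP : is_neumann_semigroup m b P) :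
  let i := feller P in
  let ii := forall alpha : R, 0 < alpha ->
    forall u : nat -> R, alpha_harmonic m b alpha u -> ell m 1 u ->
    forall x, u x = 0 in
  let ii' := forall alpha : R, 0 < alpha ->
    forall u : nat -> R, (forall x, 0 <= u x) -> alpha_harmonic m b alpha u ->
    ell m 1 u -> forall x, u x = 0 in
  let iii := vertex_measure m [set: nat] = +oo%E \/
    ((\sum_(0 <= r <oo) ((b r r.+1)^-1)%:E)%E = +oo%E /\
     (\sum_(0 <= r <oo)
        (vertex_measure m [set x | (r < x)%N] * ((b r r.+1)^-1)%:E))%E = +oo%E) in
  [/\ i <-> ii, i <-> ii' & i <-> iii].
Proof.
have m0 := vertex_measure_gt0 hb; have c0 := edge_weight_gt0 hb.
move=> i ii ii' iii.
have iP : i <-> ~ entrance_at_infinity m (edge_weight b).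
  by split; [exact: not_entrance_of_feller|exact: feller_of_not_entrance].
have iiiP : iii <-> ~ entrance_at_infinity m (edge_weight b).
  exact: volume_conditionP.
have iiP : ~ entrance_at_infinity m (edge_weight b) -> ii.
  exact: summable_harmonic_trivial.
have ii_ii' : ii -> ii' by move=> H alpha a0 u _; exact: H.
have ii'P : ii' -> ~ entrance_at_infinity m (edge_weight b).
  move=> H /(positive_summable_harmonic hb)[alpha [u [a0 u0 hu lu]]].
  by have := u0 0%N; rewrite (H alpha a0 u (fun x => ltW (u0 x)) hu lu) ltxx.
by split; tauto.
Qed.
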